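(* Let $r\in\mathbb{N}$, $A\in M(n;\mathbb{Z})$, $p,q\in\mathbb{R}^n$, $\mu=p+T'^tq$, and let $\mathcal{U}=\{V_j,U_k\}$ be as in the context. Assume $AT'=(AT')^t$, so that $\varphi^*E^{T'}_{(r,A,\mu,\mathcal{U})}\to T^{2n}_{J=T}$ is a holomorphic vector bundle. Then $$\varphi^*E^{T'}_{(r,A,\mu,\mathcal{U})}\cong\mathcal{E}_{(r,A,\mu,\mathcal{U})}$$ as holomorphic vector bundles on $T^{2n}_{J=T}$, where an isomorphism $\Psi:\varphi^*E^{T'}_{(r,A,\mu,\mathcal{U})}\to\mathcal{E}_{(r,A,\mu,\mathcal{U})}$ is given (as multiplication $s\mapsto\Psi s$ of $\mathbb{C}^{r'}$-valued functions on the universal cover $\mathbb{C}^n$) by \begin{align*} \Psi(z,\bar z)=\exp\Bigl\{&\tfrac{\mathbf{i}}{4\pi r'}z^t\bar{\mathcal{A}}z+\tfrac{\mathbf{i}}{4\pi r'}\bar z^t\mathcal{A}\bar z-\tfrac{\mathbf{i}}{2\pi r'}z^t\mathcal{A}\bar z\\ &+\tfrac{\mathbf{i}}{2\pi r}\bar z^t\{(T-\bar T)^{-1}\}^t(\delta-T)^t\mu-\tfrac{\mathbf{i}}{2\pi r}z^t\{(T-\bar T)^{-1}\}^t(\delta-\bar T)^t\bar\mu\Bigr\}\cdot I_{r'}, \end{align*} with $\mathcal{A}:=\frac{r'}{r}\{(T-\bar T)^{-1}\}^tA^t(\delta-T)(T-\bar T)^{-1}$.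
   Context: Notation: $\mathbf{i}=\sqrt{-1}$, ${}^t$ is transpose, $I_m$ the identity matrix, $\zeta:=e^{2\pi\mathbf{i}/r}$. Standing data: $T\in M(n;\mathbb{C})$ is a singular matrix with positive definite imaginary part (no symmetry of $T$ is assumed), $\delta\in M(n;\mathbb{Z})$ is a fixed matrix with $\det(T-\delta)\neq0$, and $T':=(-T+\delta)^{-1}$. Put $T^{2n}_{J=T}:=\mathbb{C}^n/2\pi(\mathbb{Z}^n\oplus T\mathbb{Z}^n)$ with complex coordinates $z=x+Ty$ ($x,y\in\mathbb{R}^n$), and $T^{2n}_{J=T'}:=\mathbb{C}^n/2\pi(\mathbb{Z}^n\oplus T'\mathbb{Z}^n)$ with complex coordinates $Z=X+T'Y$ ($X,Y\in\mathbb{R}^n$). The biholomorphic map $\varphi:T^{2n}_{J=T}\to T^{2n}_{J=T'}$ is $\varphi(z)=(-T+\delta)^{-1}z$; in real coordinates $X=-y$, $Y=x+\delta y$. The integer $r'$: choose matrices in $GL(n;\mathbb{Z})$ bringing $A$ by left and right multiplication to the Smith normal form $\mathrm{diag}(\tilde a_1,\dots,\tilde a_s,0,\dots,0)$ with $\tilde a_i\in\mathbb{N}$, $\tilde a_i\mid\tilde a_{i+1}$. Write $\tilde a_i/r=a_i'/r_i'$ in lowest terms, $r_i'\in\mathbb{N}$, and put $r':=r_1'\cdots r_s'$ ($r'=1$ if $A=0$). The bundle $E^{T'}_{(r,A,\mu,\mathcal{U})}\to T^{2n}_{J=T'}$: write $A=(a_{ij})$, $a_j:=(a_{1j},\dots,a_{nj})$.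 Let $\mathcal{U}=\{V_j,U_k\in U(r')\mid j,k=1,\dots,n\}$ satisfy $V_jV_k=V_kV_j$, $U_jU_k=U_kU_j$, $\zeta^{-a_{kj}}U_kV_j=V_jU_k$. The complex vector bundle $E^{T'}_{(r,A,\mu,\mathcal{U})}$ of rank $r'$ is the one whose smooth sections are the smooth functions $s:\mathbb{R}^{2n}\to\mathbb{C}^{r'}$ of $(X,Y)$ with $$s(X+2\pi e_j,Y)=e^{\frac{\mathbf{i}}{r}a_jY}V_j\,s(X,Y),\qquad s(X,Y+2\pi e_k)=U_k\,s(X,Y)$$ ($e_j$ standard basis vectors). It carries the connection $\nabla_{(r,A,\mu,\mathcal{U})}=d-\frac{\mathbf{i}}{2\pi}\left(\frac1rX^tA^t+\frac1r\mu^t\right)dY\cdot I_{r'}$. Only choices of $\mathcal{U}$ for which the bundle, when holomorphic, is simple (its only holomorphic endomorphisms are scalars) are considered. When $AT'=(AT')^t$, the $(0,1)$-part of this connection defines a holomorphic structure. The pullback $\varphi^*E^{T'}_{(r,A,\mu,\mathcal{U})}$ is equipped with the pullback connection and the holomorphic structure defined by its $(0,1)$-part; its sections are the functions $s(x,y)$ with $$s(x+2\pi e_j,y)=V_j'\,s(x,y),\qquad s(x,y+2\pi e_k)=e^{-\frac{\mathbf{i}}{r}a_k(x+\delta y)}U_k'\,s(x,y),$$ where $V'_j,U'_k\in U(r')$ are the unitary matrices determined by $\mathcal{U}$ through the pullback; they satisfy $V'_jV'_k=V'_kV'_j$, $U'_jU'_k=\zeta^{(A^t\delta)_{jk}-(A^t\delta)_{kj}}U'_kU'_j$,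 $\zeta^{-a_{jk}}U'_kV'_j=V'_jU'_k$. The bundle $\mathcal{E}_{(r,A,\mu,\mathcal{U})}\to T^{2n}_{J=T}$: let $L:=2\pi(\mathbb{Z}^n\oplus T\mathbb{Z}^n)$, generated by $\gamma_j:=2\pi e_j$ and $\gamma'_k:=2\pi Te_k$ ($j,k=1,\dots,n$). Let $R:=\frac{\mathbf{i}}{2\pi}\frac{r'}{r}\{(T-\bar T)^{-1}\}^tA^t$ (a real symmetric matrix when $AT'=(AT')^t$) and $\mathcal{R}(z,w):=\sum_{i,j}R_{ij}z_i\bar w_j$. Then $\mathcal{E}_{(r,A,\mu,\mathcal{U})}$ is the holomorphic vector bundle of rank $r'$ with factor of automorphy $j:L\times\mathbb{C}^n\to GL(r';\mathbb{C})$, $$j(\gamma,z)=U(\gamma)\exp\left\{\tfrac1{r'}\mathcal{R}(z,\gamma)+\tfrac1{2r'}\mathcal{R}(\gamma,\gamma)\right\},$$ that is, sections are functions $f:\mathbb{C}^n\to\mathbb{C}^{r'}$ with $f(z+\gamma)=j(\gamma,z)f(z)$, and holomorphic sections are the holomorphic such $f$. Here $U:L\to U(r')$ is determined by its values on the generators via $U(\gamma+\lambda)=U(\gamma)U(\lambda)\exp\{\frac{\mathbf{i}}{r'}\mathrm{Im}\,\mathcal{R}(\lambda,\gamma)\}$, the values on generators satisfying $U(\gamma_j)U(\gamma_k)=U(\gamma_k)U(\gamma_j)$, $U(\gamma'_j)U(\gamma'_k)=\zeta^{(A^t\delta)_{jk}-(A^t\delta)_{kj}}U(\gamma'_k)U(\gamma'_j)$,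 $\zeta^{-a_{jk}}U(\gamma'_k)U(\gamma_j)=U(\gamma_j)U(\gamma'_k)$. The values corresponding to the given $\mathcal{U}$ are, with $N:=(T-\bar T)^{-1}$, $$U(\gamma_j)=\exp\left\{\tfrac{\mathbf{i}}{r}(N^t(\delta-T)^t\mu)_j-\tfrac{\mathbf{i}}{r}(N^t(\delta-\bar T)^t\bar\mu)_j\right\}V'_j,$$ \begin{align*}U(\gamma'_k)=\exp\Bigl\{&\tfrac{\pi\mathbf{i}}{r'}(T^t\bar{\mathcal{A}}(T-\bar T))_{kk}-\tfrac{\pi\mathbf{i}}{r'}((T-\bar T)^t\mathcal{A}\bar T)_{kk}\\&+\tfrac{\mathbf{i}}{r}(\bar T^tN^t(\delta-T)^t\mu)_k-\tfrac{\mathbf{i}}{r}(T^tN^t(\delta-\bar T)^t\bar\mu)_k\Bigr\}U'_k.\end{align*} *)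

(* Defs.v *)
From HB Require Import structures.
From mathcomp Require Import all_boot all_order all_algebra.
From mathcomp Require Import complex.
From mathcomp Require Import all_classical all_reals all_analysis.

Set Implicit Arguments.
Unset Strict Implicit.
Unset Printing Implicit Defensive.

Import Order.TTheory GRing.Theory Num.Theory.
Import numFieldNormedType.Exports.

Local Open Scope ring_scope.
Local Open Scope complex_scope.

Section ComplexCalculus.
Variable R : realType.
Local Notation C := (R[i]).

Definition cexp (z : C) : C :=
  (expR (complex.Re z))%:C * (cos (complex.Im z) +i* sin (complex.Im z)).

Definition mxRe m n (M : 'M[C]_(m, n)) : 'M[R]_(m, n) := map_mx (@complex.Re R) M.
Definition mxIm m n (M : 'M[C]_(m, n)) : 'M[R]_(m, n) := map_mx (@complex.Im R) M.
Definition mxconj m n (M : 'M[C]_(m, n)) : 'M[C]_(m, n) := map_mx (@conjc R) M.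
Definition mxofR m n (M : 'M[R]_(m, n)) : 'M[C]_(m, n) :=
  map_mx (fun x : R => x%:C) M.
Definition mxofZ m n (M : 'M[int]_(m, n)) : 'M[C]_(m, n) :=
  map_mx (fun k : int => k%:~R) M.

(* The universal cover C^n as a real normed space, via real and imaginary
   parts; the real calculus of the library takes place on the latter. *)
Definition to_real n (z : 'cV[C]_n) : 'cV[R]_n * 'cV[R]_n := (mxRe z, mxIm z).
Definition of_real n (p : 'cV[R]_n * 'cV[R]_n) : 'cV[C]_n :=
  mxofR p.1 + 'i *: mxofR p.2.

Fixpoint Ck (V : normedModType R) (k : nat) (f : V -> R) : Prop :=
  if k is k'.+1
  then (forall x, differentiable f x) /\ (forall v, Ck k' ('D_v f))
  else continuous f.

Definition smooth n m1 m2 (f : 'cV[C]_n -> 'M[C]_(m1, m2)) : Prop :=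
  forall k i j,
    Ck k (fun p : 'cV[R]_n * 'cV[R]_n => complex.Re (f (of_real p) i j)) /\
    Ck k (fun p : 'cV[R]_n * 'cV[R]_n => complex.Im (f (of_real p) i j)).

(* Derivative of f at z along the REAL tangent vector v in C^n = R^(2n). *)
Definition ddir n m1 m2 (f : 'cV[C]_n -> 'M[C]_(m1, m2)) (v z : 'cV[C]_n) :
    'M[C]_(m1, m2) :=
  \matrix_(i, j)
    ('D_(to_real v) (fun p : 'cV[R]_n * 'cV[R]_n =>
                       complex.Re (f (of_real p) i j)) (to_real z) +i*
     'D_(to_real v) (fun p : 'cV[R]_n * 'cV[R]_n =>
                       complex.Im (f (of_real p) i j)) (to_real z)).

(* (0,1)-part of a 1-form alpha (a function of a tangent vector): its
   component that is antilinear for the complex structure of C^n. *)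
Definition part01 n m (alpha : 'cV[C]_n -> 'M[C]_(m, 1)) (v : 'cV[C]_n) :
    'M[C]_(m, 1) :=
  2%:R^-1 *: (alpha v + 'i *: alpha ('i *: v)).

Definition delbar n m (f : 'cV[C]_n -> 'cV[C]_m) (v z : 'cV[C]_n) : 'cV[C]_m :=
  part01 (fun w => ddir f w z) v.

End ComplexCalculus.

(* Vector bundles on a complex torus C^n / L are presented on the universal
   cover: by their smooth sections, as functions C^n -> C^m, together with a
   differential operator on C^m-valued functions, taking as further arguments
   a tangent vector v and a point z. *)
Section Bundles.
Variable R : realType.
Local Notation C := (R[i]).

(* conn E s v z is the covariant derivative of s along v at z. *)
Record conn_bundle (n m : nat) := ConnBundle {
  csec : ('cV[C]_n -> 'cV[C]_m) -> Prop;
  conn : ('cV[C]_n -> 'cV[C]_m) -> 'cV[C]_n -> 'cV[C]_n -> 'cV[C]_m }.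

(* dbar E s v z is the Dolbeault operator applied to s, along v at z. *)
Record dbar_bundle (n m : nat) := DbarBundle {
  sec : ('cV[C]_n -> 'cV[C]_m) -> Prop;
  dbar : ('cV[C]_n -> 'cV[C]_m) -> 'cV[C]_n -> 'cV[C]_n -> 'cV[C]_m }.

Definition bundle01 n m (E : conn_bundle n m) : dbar_bundle n m :=
  DbarBundle (csec E) (fun s v z => part01 (fun w => conn E s w z) v).

(* Pullback along the linear isomorphism z |-> M z of universal covers. *)
Definition pullback n m (M : 'M[C]_n) (E : conn_bundle n m) : conn_bundle n m :=
  ConnBundle
    (fun t => exists2 s, csec E s & t = (fun z => s (M *m z)))
    (fun t v z => conn E (fun Z => t (invmx M *m Z)) (M *m v) (M *m z)).

Definition lattice n (T : 'M[C]_n) (g : 'cV[C]_n) : Prop :=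
  exists a b : 'cV[int]_n, g = (2 * pi)%:C *: (mxofZ R a + T *m mxofZ R b).

Definition factor_of_automorphy n m (L : 'cV[C]_n -> Prop)
    (j : 'cV[C]_n -> 'cV[C]_n -> 'M[C]_m) : Prop :=
  forall g, L g ->
    [/\ smooth (j g),
        forall z, j g z \in unitmx
      & forall l, L l -> forall z, j (g + l) z = j g (z + l) *m j l z].

Definition automorphic n m (L : 'cV[C]_n -> Prop)
    (j : 'cV[C]_n -> 'cV[C]_n -> 'M[C]_m) (s : 'cV[C]_n -> 'cV[C]_m) : Prop :=
  forall g, L g -> forall z, s (z + g) = j g z *m s z.

Definition vector_bundle n m (L : 'cV[C]_n -> Prop) (E : dbar_bundle n m) : Prop :=
  exists2 j : 'cV[C]_n -> 'cV[C]_n -> 'M[C]_m, factor_of_automorphy L j &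
    forall s, sec E s <-> smooth s /\ automorphic L j s.

(* The first condition says that the operator descends to the torus: the forms
   d(conj z_k) being translation invariant, contraction with a constant v
   maps bundle-valued (0,1)-forms to sections. *)
Definition dolbeault_operator n m (E : dbar_bundle n m) : Prop :=
  [/\ forall s v, sec E s -> sec E (dbar E s v),
      forall s t v z, smooth s -> smooth t ->
        dbar E (fun w => s w + t w) v z = dbar E s v z + dbar E t v z,
      forall (f : 'cV[C]_n -> 'cV[C]_1) s v z, smooth f -> smooth s ->
        dbar E (fun w => f w 0 0 *: s w) v z =
        delbar f v z 0 0 *: s z + f z 0 0 *: dbar E s v z
    & forall s (c : C) v w z, smooth s ->
        dbar E s (c *: v + w) z = c^* *: dbar E s v z + dbar E s w z].

(* A Dolbeault operator defines a holomorphic structure when every point has a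
   neighbourhood with a smooth frame annihilated by it. Such a frame can be
   multiplied by a cut-off function, so it is taken defined on all of C^n. *)
Definition holomorphic_frames n m (E : dbar_bundle n m) : Prop :=
  forall z0 : 'cV[C]_n, exists2 G : 'cV[C]_n -> 'M[C]_m, smooth G &
    \forall p \near to_real z0,
      G (of_real p) \in unitmx /\
      forall (c : 'cV[C]_m) v, dbar E (fun z => G z *m c) v (of_real p) = 0.

Definition holomorphic_bundle n m (L : 'cV[C]_n -> Prop) (E : dbar_bundle n m) :=
  [/\ vector_bundle L E, dolbeault_operator E & holomorphic_frames E].

Definition holomorphic_hom n m1 m2 (E : dbar_bundle n m1) (F : dbar_bundle n m2)
    (Phi : 'cV[C]_n -> 'M[C]_(m2, m1)) : Prop :=
  smooth Phi /\
  forall s, sec E s ->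
    sec F (fun z => Phi z *m s z) /\
    forall v z, dbar F (fun w => Phi w *m s w) v z = Phi z *m dbar E s v z.

Definition holomorphic_iso n m (E F : dbar_bundle n m)
    (Psi : 'cV[C]_n -> 'M[C]_m) : Prop :=
  holomorphic_hom E F Psi /\
  exists2 Theta : 'cV[C]_n -> 'M[C]_m, holomorphic_hom F E Theta &
    forall z, Theta z *m Psi z = 1%:M /\ Psi z *m Theta z = 1%:M.

Definition simple_bundle n m (E : dbar_bundle n m) : Prop :=
  forall Phi, holomorphic_hom E E Phi -> exists c : C, forall z, Phi z = c%:M.

End Bundles.

(* rp is the product of the denominators of the elementary divisors of A
   divided by r; d lists the nonzero elementary divisors. *)
Definition smith_denominator (n r : nat) (A : 'M[int]_n) (rp : nat) : Prop :=
  exists (P Q : 'M[int]_n) (d : seq nat),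
    [/\ [/\ P \in unitmx & Q \in unitmx],
        [/\ (size d <= n)%N, all (fun a => 0 < a)%N d & sorted dvdn d],
        P *m A *m Q = \matrix_(i, j) (nth 0%N d i *+ (i == j))%:Z
      & rp = (\prod_(a <- d) `|denq (a%:R / r%:R)|)%N].

Section MirrorBundles.
Variable R : realType.
Local Notation C := (R[i]).
Variables (n r m : nat).          (* m is the rank r' of the bundles *)
Variables (T : 'M[C]_n) (delta A : 'M[int]_n) (mu : 'cV[C]_n).
Variables (V U : 'I_n -> 'M[C]_m).

Definition zeta : C := cexp ((2 * pi / r%:R)%:C * 'i).

Definition admissible_unitaries : Prop :=
  [/\ forall j, V j \is unitarymx /\ U j \is unitarymx,
      forall j k, V j *m V k = V k *m V j,
      forall j k, U j *m U k = U k *m U j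
    & forall j k, zeta ^ (- A k j) *: (U k *m V j) = V j *m U k].

Definition Tprime : 'M[C]_n := invmx (- T + mxofZ R delta).

(* The real coordinates (X, Y) of Z = X + S Y, when Im S is invertible. *)
Definition ofXY (S : 'M[C]_n) (X Y : 'cV[R]_n) : 'cV[C]_n :=
  mxofR X + S *m mxofR Y.
Definition coordY (S : 'M[C]_n) (Z : 'cV[C]_n) : 'cV[R]_n :=
  invmx (mxIm S) *m mxIm Z.
Definition coordX (S : 'M[C]_n) (Z : 'cV[C]_n) : 'cV[R]_n :=
  mxRe Z - mxRe S *m coordY S Z.

Definition E_mirror : conn_bundle R n m :=
  ConnBundle
    (fun s => smooth s /\ forall (X Y : 'cV[R]_n) (j : 'I_n),
       s (ofXY Tprime (X + (2 * pi) *: delta_mx j 0) Y) =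
         cexp ('i / r%:R * ((mxofZ R A)^T *m mxofR Y) j 0) *:
           (V j *m s (ofXY Tprime X Y)) /\
       s (ofXY Tprime X (Y + (2 * pi) *: delta_mx j 0)) =
         U j *m s (ofXY Tprime X Y))
    (fun s v Z =>
       ddir s v Z -
       ('i / (2 * pi)%:C *
         (((r%:R)^-1 *: ((mxofR (coordX Tprime Z))^T *m (mxofZ R A)^T) +
           (r%:R)^-1 *: mu^T) *m mxofR (coordY Tprime v)) 0 0) *: s Z).

Definition pullbackE : dbar_bundle R n m := bundle01 (pullback Tprime E_mirror).

Definition mxpowz (M : 'M[C]_m) (k : int) : 'M[C]_m :=
  match k with
  | Posz l => iter l (mulmx M) 1%:M
  | Negz l => iter l.+1 (mulmx (invmx M)) 1%:M
  end.

(* Transition matrices of the pullback in the coordinates z = x + T y. As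
   X = - y and Y = x + delta y, the shift of x by 2 pi e_j shifts Y by
   2 pi e_j, and the shift of y by 2 pi e_k shifts (X, Y) by
   (- 2 pi e_k, 2 pi delta e_k): the latter multiplies sections by
   V_k^-1 exp(- i/r a_k (Y + 2 pi delta e_k)) prod_l U_l^delta_lk. *)
Definition Vp (j : 'I_n) : 'M[C]_m := U j.
Definition Up (k : 'I_n) : 'M[C]_m :=
  zeta ^ (- (A^T *m delta) k k) *:
    (invmx (V k) *m \big[mulmx/1%:M]_(l < n) mxpowz (U l) (delta l k)).

Definition Nmx : 'M[C]_n := invmx (T - mxconj T).

Definition Amx : 'M[C]_n :=
  (m%:R / r%:R) *:
    (Nmx^T *m (mxofZ R A)^T *m (mxofZ R delta - T) *m Nmx).

Definition Rmx : 'M[C]_n :=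
  ('i / (2 * pi)%:C * (m%:R / r%:R)) *: (Nmx^T *m (mxofZ R A)^T).

Definition Rform (z w : 'cV[C]_n) : C :=
  \sum_(i < n) \sum_(j < n) Rmx i j * z i 0 * (w j 0)^*.

Definition gam (j : 'I_n) : 'cV[C]_n := (2 * pi)%:C *: delta_mx j 0.
Definition gam' (k : 'I_n) : 'cV[C]_n := (2 * pi)%:C *: (T *m delta_mx k 0).

Definition Ugam (j : 'I_n) : 'M[C]_m :=
  cexp ('i / r%:R * (Nmx^T *m (mxofZ R delta - T)^T *m mu) j 0
        - 'i / r%:R *
          (Nmx^T *m (mxofZ R delta - mxconj T)^T *m mxconj mu) j 0) *: Vp j.

Definition Ugam' (k : 'I_n) : 'M[C]_m :=
  cexp (pi%:C * 'i / m%:R * (T^T *m mxconj Amx *m (T - mxconj T)) k k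
        - pi%:C * 'i / m%:R * ((T - mxconj T)^T *m Amx *m mxconj T) k k
        + 'i / r%:R *
          ((mxconj T)^T *m Nmx^T *m (mxofZ R delta - T)^T *m mu) k 0
        - 'i / r%:R *
          (T^T *m Nmx^T *m (mxofZ R delta - mxconj T)^T *m mxconj mu) k 0) *: Up k.

(* Only the values of W on the lattice matter; they are determined. *)
Definition semi_representation (W : 'cV[C]_n -> 'M[C]_m) : Prop :=
  [/\ forall g, lattice T g -> W g \is unitarymx,
      forall g l, lattice T g -> lattice T l ->
        W (g + l) =
        cexp ('i / m%:R * (complex.Im (Rform l g))%:C) *: (W g *m W l),
      forall j, W (gam j) = Ugam j
    & forall k, W (gam' k) = Ugam' k].

Definition calE_factor (W : 'cV[C]_n -> 'M[C]_m) (g z : 'cV[C]_n) : 'M[C]_m :=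
  cexp ((m%:R)^-1 * Rform z g + (2 * m%:R)^-1 * Rform g g) *: W g.

Definition calE (W : 'cV[C]_n -> 'M[C]_m) : dbar_bundle R n m :=
  DbarBundle
    (fun f => smooth f /\ automorphic (lattice T) (calE_factor W) f)
    (@delbar R n m).

Definition Psi (z : 'cV[C]_n) : 'M[C]_m :=
  (cexp
    ('i / (4 * pi%:C * m%:R) * (z^T *m mxconj Amx *m z) 0 0
     + 'i / (4 * pi%:C * m%:R) * ((mxconj z)^T *m Amx *m mxconj z) 0 0
     - 'i / (2 * pi%:C * m%:R) * (z^T *m Amx *m mxconj z) 0 0
     + 'i / (2 * pi%:C * r%:R) *
       ((mxconj z)^T *m Nmx^T *m (mxofZ R delta - T)^T *m mu) 0 0
     - 'i / (2 * pi%:C * r%:R) *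
       (z^T *m Nmx^T *m (mxofZ R delta - mxconj T)^T *m mxconj mu) 0 0))%:M.

End MirrorBundles.

(* Main.v *)
From HB Require Import structures.
Require Import Defs.
From mathcomp Require Import all_boot all_order all_algebra.
From mathcomp Require Import complex.
From mathcomp Require Import ring.
From mathcomp Require Import all_classical all_reals all_analysis.

Set Implicit Arguments.
Unset Strict Implicit.
Unset Printing Implicit Defensive.

Import Order.TTheory GRing.Theory Num.Theory.
Import numFieldNormedType.Exports.

Local Open Scope ring_scope.
Local Open Scope complex_scope.

(* In the real coordinates X = - y and Y = x + delta y of z = x + T y, put
   D = delta - T and N = (T - conj T)^-1, so that z = D X + Y and
   y = N (z - conj z). The symmetry of A T' says that S = A^t D is symmetric,
   which makes K = A N = N^t A^t symmetric as well, and the exponent of Psi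
   becomes G(z) = i/(4 pi r) (y^t S y + z^t K z) + (a real linear form).
   The lattice consists of the vectors g = 2 pi (D c + d), and a shift by g
   multiplies the sections of the pullback by
   exp(i/r c^t A^t (Y + 2 pi d)) V^c U^d. The identity
   G(z + g) + i/r c^t A^t Y(z) = G(z) + G(g) + R(z, g)/r' then shows that exp G
   turns this cocycle into j(g, z), with
   W(g) = exp(G(g) - R(g, g)/(2r') + (2 pi i/r) c^t A^t d) V^c U^d, which is
   unitary because the exponent is imaginary. As the (0,1)-part of the
   connection form of the pullback is the (0,1)-part of d G, exp G also
   intertwines the Dolbeault operators, and the holomorphic structure of the
   pullback is transported from that of the bundle with factor j. *)

(** * Real calculus on C^n *)

(** The coordinates (X, Y) are preferred to (x, y) because they separate the noncommuting matrices:
    a shift of X involves only the V_j and a shift of Y only the U_k, each a commuting family, while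
    the matrices attached to shifts of y need not commute with one another. So V^c and U^d are
    homomorphisms in c and d, and a single crossing rule, U^d V^c = zeta^(d^t A c) V^c U^d, carries
    all the noncommutativity; its phase is absorbed by the term c^t A^t d in the exponent of W. The
    theorem quantifies over every semi-representation with the prescribed values on the generators,
    whereas the cocycle computation produces one explicit W. The two are identified by uniqueness:
    the places where two solutions agree form a subgroup of the lattice. Neither the Dolbeault
    axioms nor the holomorphic frames are checked on the pullback itself. R(z, g) is complex linear
    in z, so j(g, z) is holomorphic and the constant vectors are a holomorphic frame on the other
    side; multiplied by exp(- G) they become a frame of the pullback. *)

Lemma eq_derive (R : realType) (V W : normedModType R) (f : V -> R) (g : W -> R)
    (x v : V) (y w : W) :
  (forall h : R, f (h *: v + x) = g (h *: w + y)) -> 'D_v f x = 'D_w g y.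
Proof.
move=> fg; have fgx : f x = g y by have := fg 0; rewrite !scale0r !add0r.
rewrite /derive (_ : (fun h : R => _) =
  fun h : R => h^-1 *: ((g \o shift y) (h *: w) - g y)) //.
by apply/funext => h; rewrite /= fg fgx.
Qed.

Lemma derive_linear (R : realType) (V : normedModType R) (f : V -> R) (a : R)
    (v w x : V) :
  differentiable f x -> 'D_(a *: v + w) f x = a * 'D_v f x + 'D_w f x.
Proof. by move=> df; rewrite !deriveE // linearD linearZ. Qed.

Section CkFunctions.
Variables (R : realType) (V : normedModType R).
Implicit Types f g : V -> R.

Lemma Ck_continuous k f : Ck k f -> continuous f.
Proof.
case: k => [//|k] [df _] x; exact/differentiable_continuous/df.
Qed.

(** The product and chain rules return the undifferentiated factors inside the derivative, where one
    order less is asked of them. *)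
Lemma CkW k f : Ck k.+1 f -> Ck k f.
Proof.
elim: k f => [|k IH] f; first exact: Ck_continuous.
by case=> df Df; split => // v; apply: IH.
Qed.

Lemma Ck_cst k (a : R) : Ck k (cst a : V -> R).
Proof.
elim: k a => [|k IH] a /=; first exact: cst_continuous.
split=> [x|v]; first exact: differentiable_cst.
by rewrite (_ : 'D_v _ = cst 0) //; apply/funext => x; rewrite derive_cst.
Qed.

Lemma CkD k f g : Ck k f -> Ck k g -> Ck k (fun x => f x + g x).
Proof.
elim: k f g => [|k IH] f g; first by move=> cf cg x; exact: (cvgD (cf x) (cg x)).
case=> df Df [dg Dg]; split => [x|v]; first exact: differentiableD.
rewrite (_ : 'D_v _ = fun x => 'D_v f x + 'D_v g x); first exact: (IH _ _ (Df v) (Dg v)).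
by apply/funext => x; rewrite deriveD//; exact: diff_derivable.
Qed.

Lemma CkM k f g : Ck k f -> Ck k g -> Ck k (fun x => f x * g x).
Proof.
elim: k f g => [|k IH] f g; first by move=> cf cg x; exact: (cvgM (cf x) (cg x)).
move=> Cf Cg; have [df Df] := Cf; have [dg Dg] := Cg.
split => [x|v]; first exact: differentiableM.
rewrite (_ : 'D_v _ = fun x => f x * 'D_v g x + g x * 'D_v f x).
  exact: (CkD (IH _ _ (CkW Cf) (Dg v)) (IH _ _ (CkW Cg) (Df v))).
by apply/funext => x; rewrite deriveM//; exact: diff_derivable.
Qed.

Lemma CkN k f : Ck k f -> Ck k (fun x => - f x).
Proof.
move=> Cf; rewrite (_ : (fun x => _) = fun x => cst (-1) x * f x).
  by apply: CkM => //; exact: Ck_cst.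
by apply/funext => x; rewrite mulN1r.
Qed.

Lemma derive_comp1 (phi dphi : R -> R) f x v :
  (forall y : R, is_derive y (1 : R) phi (dphi y)) -> differentiable f x ->
  'D_v (phi \o f) x = dphi (f x) * 'D_v f x.
Proof.
move=> dphiE df.
have dphif : differentiable phi (f x) by apply/derivable1_diffP; apply: ex_derive.
rewrite !deriveE//; last exact: differentiable_comp.
rewrite diff_comp//= diff1E// derive1E.
have -> : 'D_1 phi (f x) = dphi (f x) by apply: derive_val.
by rewrite /GRing.scale /= mulrC.
Qed.

(** The induction on the order meets every derivative of the outer function, so they are all
    supplied at once: [phi i.+1] is the derivative of [phi i]. *)
Lemma Ck_comp1 (phi : nat -> R -> R) k i f :
  (forall i (y : R), is_derive y (1 : R) (phi i) (phi i.+1 y)) ->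
  Ck k f -> Ck k (phi i \o f).
Proof.
move=> dphi; elim: k i f => [|k IH] i f Cf.
  move=> x; apply: continuous_comp; first exact: Cf.
  by apply/differentiable_continuous/derivable1_diffP; apply: ex_derive.
have [df Df] := Cf; split => [x|v].
  apply: differentiable_comp => //.
  by apply/derivable1_diffP; apply: ex_derive.
rewrite (_ : 'D_v _ = fun x => (phi i.+1 \o f) x * 'D_v f x).
  exact: (CkM (IH _ _ (CkW Cf)) (Df v)).
by apply/funext => x; rewrite (derive_comp1 v (dphi i)).
Qed.

Lemma Ck_expR k f : Ck k f -> Ck k (fun x => expR (f x)).
Proof. by apply: (@Ck_comp1 (fun=> expR) k 0) => _ y; exact: is_derive_expR. Qed.

Lemma Ck_cos_sin k f : Ck k f ->
  Ck k (fun x => cos (f x)) /\ Ck k (fun x => sin (f x)).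
Proof.
(* The i-th derivative of the cosine is its translate by i quarter periods; i = 1 gives minus the
   sine. *)
pose phi i y : R := cos (y + i%:R * (pi / 2)).
have phiS i y : phi i.+1 y = - sin (y + i%:R * (pi / 2)).
  by rewrite /phi -natr1 mulrDl mul1r addrA cosDpihalf.
have dphi i (y : R) : is_derive y (1 : R) (phi i) (phi i.+1 y).
  rewrite phiS -[- sin _](mulr1) /phi.
  apply: (@is_derive1_comp R cos (fun y => y + i%:R * (pi / 2))).
  by apply: is_derive_eq; rewrite addr0.
move=> Cf; split.
  have := Ck_comp1 0 dphi Cf; congr Ck; apply/funext => x.
  by rewrite /= /phi mul0r addr0.
have := CkN (Ck_comp1 1 dphi Cf); congr Ck; apply/funext => x.
by rewrite /= phiS mul0r addr0 opprK.
Qed.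

Lemma Ck_linear k (f : {linear V -> R}) : continuous f -> Ck k f.
Proof.
move=> cf; case: k => [//|k]; split => [x|v]; first exact: linear_differentiable.
rewrite (_ : 'D_v _ = cst (f v)); first exact: Ck_cst.
apply/funext => x; rewrite deriveE; last exact: linear_differentiable.
by rewrite diff_lin.
Qed.

(** The derivative along v is the derivative of f along L v, precomposed with the same affine map,
    so the induction stays within one family of functions. *)
Lemma Ck_affine (W : normedModType R) k (L : {linear W -> V}) (b : V) f :
  continuous L -> Ck k f -> Ck k (fun x => f (L x + b)).
Proof.
move=> cL; elim: k f => [|k IH] f.
  move=> cf x; apply: (@continuous_comp _ _ _ (fun x => L x + b) f).
    exact: (cvgD (cL x) (cvg_cst b)).
  exact: cf.
case=> df Df; split => [x|v].
  apply: (@differentiable_comp _ _ _ _ (fun x => L x + b) f) => //.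
  apply: (@differentiableD _ _ _ L (cst b)).
    exact: linear_differentiable.
  exact: differentiable_cst.
rewrite (_ : 'D_v _ = fun x => 'D_(L v) f (L x + b)); first exact: (IH _ (Df _)).
apply/funext => x; apply: eq_derive => h.
by rewrite linearD linearZ addrA.
Qed.

End CkFunctions.

(** Finite dimension: expanded on the standard basis, the map is a finite sum of coordinates times
    fixed vectors, and coordinates are continuous. *)
Lemma linear_col_pair_continuous (R : realType) n1 n2 (W : normedModType R)
    (f : {linear ('cV[R]_n1 * 'cV[R]_n2)%type -> W}) : continuous f.
Proof.
have -> : f = (fun p => \sum_i p.1 i 0 *: f (delta_mx i 0, 0) +
                        \sum_i p.2 i 0 *: f (0, delta_mx i 0)) :> (_ -> _).
  apply/funext => -[a b] /=.
  rewrite [in LHS](_ : (a, b) = (a, 0) + (0, b)); last first.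
    by congr pair; rewrite ?addr0 ?add0r.
  rewrite linearD; congr (_ + _).
    rewrite [in LHS](_ : (a, 0) = \sum_i a i 0 *: (delta_mx i 0, 0) :> 'cV[R]_n1 * 'cV[R]_n2).
      by rewrite linear_sum; apply: eq_bigr => i _; rewrite linearZ.
    rewrite [in LHS](matrix_sum_delta a).
    rewrite (eq_bigr (fun i => a i 0 *: delta_mx i 0)); last by move=> i _; rewrite big_ord1.
    elim/big_ind2: _ => // [x1 x2 y1 y2 <- <-|i _].
      by congr pair; rewrite addr0.
    by congr pair; rewrite scaler0.
  rewrite [in LHS](_ : (0, b) = \sum_i b i 0 *: (0, delta_mx i 0) :> 'cV[R]_n1 * 'cV[R]_n2).
    by rewrite linear_sum; apply: eq_bigr => i _; rewrite linearZ.
  rewrite [in LHS](matrix_sum_delta b).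
  rewrite (eq_bigr (fun i => b i 0 *: delta_mx i 0)); last by move=> i _; rewrite big_ord1.
  elim/big_ind2: _ => // [x1 x2 y1 y2 <- <-|i _].
    by congr pair; rewrite addr0.
  by congr pair; rewrite scaler0.
move=> p; apply: cvgD.
  apply: cvg_big => [|i _]; first exact: add_continuous.
  apply: cvgZr_tmp.
  apply: (@continuous_comp _ _ _ fst (fun M : 'cV[R]_n1 => M i 0)).
    exact: cvg_fst.
  exact: coord_continuous.
apply: cvg_big => [|i _]; first exact: add_continuous.
apply: cvgZr_tmp.
apply: (@continuous_comp _ _ _ snd (fun M : 'cV[R]_n2 => M i 0)).
  exact: cvg_snd.
exact: coord_continuous.
Qed.

(** * Real and imaginary parts, and the complex exponential *)

Section ComplexParts.
Variable R : realType.
Local Notation C := R[i].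
Implicit Types x y : C.

Lemma Re_add x y : complex.Re (x + y) = complex.Re x + complex.Re y.
Proof. by case: x y => [a b] [c d]. Qed.

Lemma Im_add x y : complex.Im (x + y) = complex.Im x + complex.Im y.
Proof. by case: x y => [a b] [c d]. Qed.

Lemma Re_mul x y :
  complex.Re (x * y) = complex.Re x * complex.Re y - complex.Im x * complex.Im y.
Proof. by case: x y => [a b] [c d]. Qed.

Lemma Im_mul x y :
  complex.Im (x * y) = complex.Re x * complex.Im y + complex.Im x * complex.Re y.
Proof. by case: x y => [a b] [c d]. Qed.

Lemma complex_ext x y :
  complex.Re x = complex.Re y -> complex.Im x = complex.Im y -> x = y.
Proof. by case: x y => [a b] [c d] /= -> ->. Qed.

Lemma cexpD x y : cexp (x + y) = cexp x * cexp y.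
Proof.
rewrite /cexp Re_add Im_add expRD cosD sinD.
apply: complex_ext; rewrite !(Re_mul, Im_mul) /=; ring.
Qed.

Lemma cexp0 : cexp (0 : C) = 1.
Proof. by rewrite /cexp /= expR0 cos0 sin0 mul1r. Qed.

Lemma cexpK x : cexp x * cexp (- x) = 1.
Proof. by rewrite -cexpD subrr cexp0. Qed.

Lemma cexp_neq0 x : cexp x != 0.
Proof.
by apply/eqP => x0; have /eqP := cexpK x; rewrite x0 mul0r eq_sym oner_eq0.
Qed.

Lemma cexpN x : cexp (- x) = (cexp x)^-1.
Proof. by apply: (mulfI (cexp_neq0 x)); rewrite cexpK divff // cexp_neq0. Qed.

Lemma cexp_conj x : (cexp x)^* = cexp x^*.
Proof.
by case: x => a b; apply: complex_ext; rewrite /cexp /= ?cosN ?sinN; ring.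
Qed.

End ComplexParts.

(* Locked, as conversion between derivatives along different vectors would
   unfold limits. *)
HB.lock Definition cder (R : realType) n (f : 'cV[R[i]]_n -> R[i])
    (v z : 'cV[R[i]]_n) : R[i] :=
  'D_(to_real v) (fun p : 'cV[R]_n * 'cV[R]_n => complex.Re (f (of_real p))) (to_real z) +i*
  'D_(to_real v) (fun p : 'cV[R]_n * 'cV[R]_n => complex.Im (f (of_real p))) (to_real z).

(** * Smoothness and real directional derivatives of complex-valued functions on C^n *)

Section ComplexDerivative.
Variable R : realType.
Local Notation C := R[i].

Definition csmooth n (f : 'cV[C]_n -> C) : Prop :=
  forall k, Ck k (fun p : 'cV[R]_n * 'cV[R]_n => complex.Re (f (of_real p))) /\
            Ck k (fun p : 'cV[R]_n * 'cV[R]_n => complex.Im (f (of_real p))).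

Lemma to_realK n : cancel (@to_real R n) (@of_real R n).
Proof.
move=> z; apply/matrixP => i j; rewrite !mxE /=.
by apply: complex_ext; rewrite !(Re_add, Im_add, Re_mul, Im_mul) /=; ring.
Qed.

Lemma of_realK n : cancel (@of_real R n) (@to_real R n).
Proof.
by move=> [a b]; congr pair; apply/matrixP => i j; rewrite !mxE /=; ring.
Qed.

Lemma of_real_linear n (h : R) (p q : 'cV[R]_n * 'cV[R]_n) :
  of_real (h *: p + q) = h%:C *: of_real p + of_real q.
Proof.
apply/matrixP => i j; rewrite !mxE /=.
by apply: complex_ext; rewrite !(Re_add, Im_add, Re_mul, Im_mul) /=; ring.
Qed.

Lemma to_real_linear n (h : R) (z w : 'cV[C]_n) :
  to_real (h%:C *: z + w) = h *: to_real z + to_real w.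
Proof. by apply: (can_inj (@of_realK n)); rewrite of_real_linear !to_realK. Qed.

Section Scalar.
Variable n : nat.
Implicit Types (f g : 'cV[C]_n -> C) (v w z : 'cV[C]_n).

Lemma csmooth_diff f : csmooth f -> forall z : 'cV[R]_n * 'cV[R]_n,
  differentiable (fun p : 'cV[R]_n * 'cV[R]_n => complex.Re (f (of_real p))) z /\
  differentiable (fun p : 'cV[R]_n * 'cV[R]_n => complex.Im (f (of_real p))) z.
Proof. by move=> /(_ 1%N) [[dRe _] [dIm _]] z; split. Qed.

Lemma csmooth_cst (a : C) : csmooth (fun _ : 'cV[C]_n => a).
Proof. by move=> k; split; exact: Ck_cst. Qed.

Lemma csmoothD f g : csmooth f -> csmooth g -> csmooth (fun z => f z + g z).
Proof.
move=> sf sg k; have [Rf If] := sf k; have [Rg Ig] := sg k; split.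
  by under eq_fun do rewrite Re_add; exact: CkD.
by under eq_fun do rewrite Im_add; exact: CkD.
Qed.

Lemma csmoothM f g : csmooth f -> csmooth g -> csmooth (fun z => f z * g z).
Proof.
move=> sf sg k; have [Rf If] := sf k; have [Rg Ig] := sg k; split.
  by under eq_fun do rewrite Re_mul; apply: CkD; [exact: CkM|apply: CkN; exact: CkM].
by under eq_fun do rewrite Im_mul; apply: CkD; exact: CkM.
Qed.

Lemma csmooth_sum (I : Type) (s : seq I) (P : pred I) (F : I -> 'cV[C]_n -> C) :
  (forall i, P i -> csmooth (F i)) -> csmooth (fun z => \sum_(i <- s | P i) F i z).
Proof.
move=> sF; elim: s => [|i s IH].
  by under eq_fun do rewrite big_nil; exact: csmooth_cst.
case: (boolP (P i)) => Pi; last by under eq_fun do rewrite big_cons (negPf Pi).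
by under eq_fun do rewrite big_cons Pi; exact: (csmoothD (sF i Pi) IH).
Qed.

Lemma csmooth_cexp f : csmooth f -> csmooth (fun z => cexp (f z)).
Proof.
move=> sf k; have [Rf If] := sf k; have [cf sf'] := Ck_cos_sin If.
by split; under eq_fun do rewrite /cexp (Re_mul, Im_mul) /= mul0r (subr0, addr0);
  apply: CkM => //; exact: Ck_expR.
Qed.

(** Only real scalars are asked for, since coordinates such as y involve complex conjugation. *)
Lemma csmooth_real_linear f :
  (forall (h : R) v z, f (h%:C *: v + z) = h%:C * f v + f z) -> csmooth f.
Proof.
move=> flin.
have Re_lin : linear (fun p : 'cV[R]_n * 'cV[R]_n => complex.Re (f (of_real p))).
  by move=> h p q; rewrite of_real_linear flin Re_add Re_mul /= mul0r subr0.
have Im_lin : linear (fun p : 'cV[R]_n * 'cV[R]_n => complex.Im (f (of_real p))).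
  by move=> h p q; rewrite of_real_linear flin Im_add Im_mul /= mul0r addr0.
pose L1 : {linear _ -> _} := HB.pack
  (fun p : 'cV[R]_n * 'cV[R]_n => complex.Re (f (of_real p)))
  (GRing.isLinear.Build _ _ _ _ _ Re_lin).
pose L2 : {linear _ -> _} := HB.pack
  (fun p : 'cV[R]_n * 'cV[R]_n => complex.Im (f (of_real p)))
  (GRing.isLinear.Build _ _ _ _ _ Im_lin).
move=> k; split.
  exact: (@Ck_linear _ _ k L1 (@linear_col_pair_continuous _ _ _ _ L1)).
exact: (@Ck_linear _ _ k L2 (@linear_col_pair_continuous _ _ _ _ L2)).
Qed.

Lemma cder_cst (a : C) v z : cder (fun _ : 'cV[C]_n => a) v z = 0.
Proof. by rewrite cder.unlock !derive_cst. Qed.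

Lemma cderD f g v z : csmooth f -> csmooth g ->
  cder (fun z => f z + g z) v z = cder f v z + cder g v z.
Proof.
move=> sf sg; have [Rf If] := csmooth_diff sf (to_real z).
have [Rg Ig] := csmooth_diff sg (to_real z).
rewrite cder.unlock; under eq_fun do rewrite Re_add.
under [X in _ +i* 'D__ X _]eq_fun do rewrite Im_add.
by rewrite !deriveD //; exact: diff_derivable.
Qed.

Lemma cderM f g v z : csmooth f -> csmooth g ->
  cder (fun z => f z * g z) v z = cder f v z * g z + f z * cder g v z.
Proof.
move=> sf sg; have [Rf If] := csmooth_diff sf (to_real z).
have [Rg Ig] := csmooth_diff sg (to_real z).
rewrite cder.unlock; under eq_fun do rewrite Re_mul.
under [X in _ +i* 'D__ X _]eq_fun do rewrite Im_mul.
have dV := diff_derivable.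
rewrite deriveB; [|by apply: derivableM; exact: dV|by apply: derivableM; exact: dV].
rewrite deriveD; [|by apply: derivableM; exact: dV|by apply: derivableM; exact: dV].
rewrite !deriveM; do ?exact: dV.
rewrite !to_realK.
by apply: complex_ext; rewrite !(Re_add, Im_add, Re_mul, Im_mul) /= /GRing.scale /=; ring.
Qed.

Lemma cder_sum (I : Type) (s : seq I) (P : pred I) (F : I -> 'cV[C]_n -> C) v z :
  (forall i, P i -> csmooth (F i)) ->
  cder (fun z => \sum_(i <- s | P i) F i z) v z = \sum_(i <- s | P i) cder (F i) v z.
Proof.
move=> sF; elim: s => [|i s IH].
  by under eq_fun do rewrite big_nil; rewrite cder_cst big_nil.
rewrite big_cons; case: (boolP (P i)) => Pi.
  under eq_fun do rewrite big_cons Pi.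
  by rewrite cderD ?IH//; [exact: sF|exact: csmooth_sum].
by under eq_fun do rewrite big_cons (negPf Pi).
Qed.

Lemma cder_cexp f v z : csmooth f ->
  cder (fun z => cexp (f z)) v z = cexp (f z) * cder f v z.
Proof.
move=> sf; have [Rf If] := csmooth_diff sf (to_real z).
have Rcexp (w : C) : complex.Re (cexp w) = expR (complex.Re w) * cos (complex.Im w).
  by rewrite /cexp Re_mul /= mul0r subr0.
have Icexp (w : C) : complex.Im (cexp w) = expR (complex.Re w) * sin (complex.Im w).
  by rewrite /cexp Im_mul /= mul0r addr0.
have dexp := @derive_comp1 R _ expR expR _ (to_real z) (to_real v)
  (fun y => is_derive_expR y) Rf.
have dcos := @derive_comp1 R _ cos (fun y => - sin y) _ (to_real z) (to_real v)
  (fun y => is_derive_cos y) If.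
have dsin := @derive_comp1 R _ sin cos _ (to_real z) (to_real v)
  (fun y => is_derive_sin y) If.
have s1 := csmooth_cexp sf.
rewrite cder.unlock; under eq_fun do rewrite Rcexp.
under [X in _ +i* 'D__ X _]eq_fun do rewrite Icexp.
have d1 : derivable (expR \o (fun p => complex.Re (f (of_real p)))) (to_real z) (to_real v).
  apply/diff_derivable/differentiable_comp => //.
  by apply/derivable1_diffP; apply: ex_derive.
have d2 : derivable (cos \o (fun p => complex.Im (f (of_real p)))) (to_real z) (to_real v).
  apply/diff_derivable/differentiable_comp => //.
  by apply/derivable1_diffP; apply: ex_derive.
have d3 : derivable (sin \o (fun p => complex.Im (f (of_real p)))) (to_real z) (to_real v).
  apply/diff_derivable/differentiable_comp => //.
  by apply/derivable1_diffP; apply: ex_derive.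
have -> := deriveM d1 d2; have -> := deriveM d1 d3.
rewrite dexp dcos dsin /= !to_realK.
by apply: complex_ext; rewrite !(Re_mul, Im_mul) /= ?Rcexp ?Icexp /GRing.scale /=; ring.
Qed.

(** A directional derivative sees only the restriction to one line, so translations and linear
    substitutions, even between different spaces, need no chain rule. *)
Lemma eq_cder m f (g : 'cV[C]_m -> C) v z (w y : 'cV[C]_m) :
  (forall h : R, f (h%:C *: v + z) = g (h%:C *: w + y)) ->
  cder f v z = cder g w y.
Proof.
by move=> fg; rewrite cder.unlock; congr Complex; apply: eq_derive => h;
  rewrite -!to_real_linear !to_realK fg.
Qed.

Lemma cder_linear f (a : R) v w z : csmooth f ->
  cder f (a%:C *: v + w) z = a%:C * cder f v z + cder f w z.
Proof.
move=> sf; have [Rf If] := csmooth_diff sf (to_real z).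
rewrite cder.unlock to_real_linear (derive_linear _ _ _ Rf) (derive_linear _ _ _ If).
have key (x y x' y' : R) :
    (a * x + x') +i* (a * y + y') = a%:C * (x +i* y) + (x' +i* y').
  by apply: complex_ext; rewrite !(Re_add, Im_add, Re_mul, Im_mul) /=; ring.
exact: key.
Qed.

Lemma cder_real_linear f v z :
  (forall (h : R) v z, f (h%:C *: v + z) = h%:C * f v + f z) -> cder f v z = f v.
Proof.
move=> flin; rewrite cder.unlock.
have line (g : 'cV[C]_n -> R) : (forall h : R, g (h%:C *: v + z) = h * g v + g z) ->
    'D_(to_real v) (fun p => g (of_real p)) (to_real z) = g v.
  (* On the line through z along v, g is an affine function of one real variable. *)
  move=> gE; transitivity ('D_1 (fun h : R => h * g v + g z) 0).
    by apply: eq_derive => h; rewrite -to_real_linear to_realK gE addr0 [h *: 1]mulr1.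
  apply: derive_val; apply: is_derive_eq.
  by rewrite /GRing.scale /= ?mulr0 ?add0r ?addr0 mulr1.
rewrite (line (fun z => complex.Re (f z))) 1?(line (fun z => complex.Im (f z))).
- by case: (f v).
- by move=> h; rewrite flin Im_add Im_mul /= mul0r addr0.
- by move=> h; rewrite flin Re_add Re_mul /= mul0r subr0.
Qed.

Lemma csmooth_cder f v : csmooth f -> csmooth (cder f v).
Proof.
move=> sf k; have [[_ Rf] [_ If]] := sf k.+1.
have cderE (p : 'cV[R]_n * 'cV[R]_n) : cder f v (of_real p) =
    'D_(to_real v) (fun p : 'cV[R]_n * 'cV[R]_n => complex.Re (f (of_real p))) p +i*
    'D_(to_real v) (fun p : 'cV[R]_n * 'cV[R]_n => complex.Im (f (of_real p))) p.
  by rewrite cder.unlock of_realK.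
split; under eq_fun do rewrite cderE.
  exact: Rf.
exact: If.
Qed.

End Scalar.

Lemma csmooth_affine n m (M : 'M[C]_(m, n)) (b : 'cV[C]_m) (f : 'cV[C]_m -> C) :
  csmooth f -> csmooth (fun z => f (M *m z + b)).
Proof.
move=> sf k; have [Rf If] := sf k.
have Llin : linear (fun p : 'cV[R]_n * 'cV[R]_n => to_real (M *m of_real p)).
  by move=> a p q; rewrite of_real_linear mulmxDr -scalemxAr to_real_linear.
pose L : {linear _ -> _} := HB.pack (fun p : 'cV[R]_n * 'cV[R]_n => to_real (M *m of_real p))
  (GRing.isLinear.Build _ _ _ _ _ Llin).
have LE (p : 'cV[R]_n * 'cV[R]_n) : M *m of_real p + b = of_real (L p + to_real b).
  by rewrite -[L p]scale1r of_real_linear scale1r !to_realK.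
have cL : continuous L by exact: linear_col_pair_continuous.
split; under eq_fun do rewrite LE.
  exact: (Ck_affine (to_real b) cL Rf).
exact: (Ck_affine (to_real b) cL If).
Qed.

End ComplexDerivative.

(** * Dolbeault operators *)

Section MatrixDerivative.
Variable R : realType.
Local Notation C := R[i].

Lemma smoothP n m1 m2 (f : 'cV[C]_n -> 'M[C]_(m1, m2)) :
  smooth f <-> forall i j, csmooth (fun z => f z i j).
Proof. by split=> [sf i j k|sf k i j]; [exact: (sf k i j)|exact: (sf i j k)]. Qed.

Lemma ddirE n m1 m2 (f : 'cV[C]_n -> 'M[C]_(m1, m2)) v z i j :
  ddir f v z i j = cder (fun z => f z i j) v z.
Proof. by rewrite mxE cder.unlock. Qed.

Lemma csmooth_shift n (f : 'cV[C]_n -> C) b : csmooth f -> csmooth (fun z => f (z + b)).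
Proof. by move=> /(csmooth_affine 1%:M b); under eq_fun do rewrite mul1mx. Qed.

Lemma addmxE m1 m2 (A B : 'M[C]_(m1, m2)) i j : (A + B) i j = A i j + B i j.
Proof. by rewrite mxE. Qed.

Lemma scalemxE m1 m2 (a : C) (A : 'M[C]_(m1, m2)) i j : (a *: A) i j = a * A i j.
Proof. by rewrite mxE. Qed.

Section Rules.
Variables (n m1 m2 m3 : nat).
Implicit Types (f g : 'cV[C]_n -> 'M[C]_(m1, m2)) (h : 'cV[C]_n -> 'M[C]_(m2, m3)).
Implicit Types (a : 'cV[C]_n -> C).

Lemma smooth_cst (M : 'M[C]_(m1, m2)) : smooth (fun _ : 'cV[C]_n => M).
Proof. by apply/smoothP => i j; exact: csmooth_cst. Qed.

Lemma smoothD f g : smooth f -> smooth g -> smooth (fun z => f z + g z).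
Proof.
move=> /smoothP sf /smoothP sg; apply/smoothP => i j.
by under eq_fun do rewrite mxE; exact: (csmoothD (sf i j) (sg i j)).
Qed.

Lemma smoothZ a f : csmooth a -> smooth f -> smooth (fun z => a z *: f z).
Proof.
move=> sa /smoothP sf; apply/smoothP => i j.
by under eq_fun do rewrite mxE; exact: (csmoothM sa (sf i j)).
Qed.

Lemma smooth_mulmx f h : smooth f -> smooth h -> smooth (fun z => f z *m h z).
Proof.
move=> /smoothP sf /smoothP sh; apply/smoothP => i j.
by under eq_fun do rewrite mxE; exact: (csmooth_sum _ (fun k _ => csmoothM (sf i k) (sh k j))).
Qed.

End Rules.

Definition cdbar n (f : 'cV[C]_n -> C) (v z : 'cV[C]_n) : C :=
  2%:R^-1 * (cder f v z + 'i * cder f ('i *: v) z).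

Lemma i_sq : 'i * 'i = -1 :> C.
Proof. by rewrite -expr2 sqr_i. Qed.

Lemma part01E n m (alpha : 'cV[C]_n -> 'cV[C]_m) v i :
  part01 alpha v i 0 = 2%:R^-1 * (alpha v i 0 + 'i * alpha ('i *: v) i 0).
Proof. by rewrite /part01 scalemxE addmxE scalemxE. Qed.

Lemma part01_ext n (alpha beta : 'cV[C]_n -> C) (v : 'cV[C]_n) :
  alpha =1 beta -> 2%:R^-1 * (alpha v + 'i * alpha ('i *: v)) =
                   2%:R^-1 * (beta v + 'i * beta ('i *: v)).
Proof. by move=> ab; rewrite !ab. Qed.

Lemma delbarE n m (s : 'cV[C]_n -> 'cV[C]_m) v z i :
  delbar s v z i 0 = cdbar (fun z => s z i 0) v z.
Proof.
apply: (etrans (part01E (fun w => ddir s w z) v i)).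
exact: (@part01_ext n (fun w => ddir s w z i 0) (fun w => cder (fun z => s z i 0) w z) v
  (fun w => ddirE s w z i 0)).
Qed.

Section ScalarDolbeault.
Variables (n : nat).
Implicit Types (a b : 'cV[C]_n -> C).

Lemma cdbar_cst (c : C) v (z : 'cV[C]_n) : cdbar (fun _ => c) v z = 0.
Proof. by rewrite /cdbar !cder_cst mulr0 addr0 mulr0. Qed.

Lemma cdbarD a b v z : csmooth a -> csmooth b ->
  cdbar (fun w => a w + b w) v z = cdbar a v z + cdbar b v z.
Proof. by move=> sa sb; rewrite /cdbar !cderD//; ring. Qed.

Lemma cdbarM a b v z : csmooth a -> csmooth b ->
  cdbar (fun w => a w * b w) v z = cdbar a v z * b z + a z * cdbar b v z.
Proof. by move=> sa sb; rewrite /cdbar !cderM//; ring. Qed.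

Lemma cdbar_sum (I : Type) (s : seq I) (P : pred I) (F : I -> 'cV[C]_n -> C) v z :
  (forall i, P i -> csmooth (F i)) ->
  cdbar (fun z => \sum_(i <- s | P i) F i z) v z = \sum_(i <- s | P i) cdbar (F i) v z.
Proof.
move=> sF; rewrite /cdbar !cder_sum//.
by rewrite -mulr_sumr big_split /= mulr_sumr.
Qed.

Lemma csmooth_cdbar a v : csmooth a -> csmooth (cdbar a v).
Proof.
move=> sa; apply: (@csmoothM _ _ (fun=> _) _ (csmooth_cst _ _)).
apply: (@csmoothD _ _ _ _ (csmooth_cder v sa)).
exact: (@csmoothM _ _ (fun=> _) _ (csmooth_cst _ _) (csmooth_cder _ sa)).
Qed.

Lemma cdbar_antilinear a (c : C) v w z : csmooth a ->
  cdbar a (c *: v + w) z = conjc c * cdbar a v z + cdbar a w z.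
Proof.
move=> sa.
(* Smoothness of a serves only to make the derivative real linear in the direction; the (0,1)-part
   of any real-linear form is antilinear. *)
suff gen (D : 'cV[C]_n -> C) : (forall (k : R) x y, D (k%:C *: x + y) = k%:C * D x + D y) ->
    2%:R^-1 * (D (c *: v + w) + 'i * D ('i *: (c *: v + w))) =
    conjc c * (2%:R^-1 * (D v + 'i * D ('i *: v))) + 2%:R^-1 * (D w + 'i * D ('i *: w)).
  exact: (gen (cder a ^~ z) (fun k x y => cder_linear k x y z sa)).
move=> Dlin.
have DD x y : D (x + y) = D x + D y.
  by have := Dlin 1 x y; rewrite scale1r mul1r.
have DZ (k : R) x : D (k%:C *: x) = k%:C * D x.
  have D0 : D 0 = 0.
    by have := DD 0 0; rewrite addr0 => /(congr1 (fun x => x - D 0)); rewrite subrr addrK.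
  by have := Dlin k x 0; rewrite !addr0 D0 addr0.
have DC (d : C) x : D (d *: x) =
    (complex.Re d)%:C * D x + (complex.Im d)%:C * D ('i *: x).
  by rewrite [in LHS](complexE d) scalerDl mulrC -scalerA DD !DZ.
rewrite scalerDr !DD scalerA (DC c v) (DC ('i * c) v).
have -> : complex.Re ('i * c) = - complex.Im c by case: c => x y /=; ring.
have -> : complex.Im ('i * c) = complex.Re c by case: c => x y /=; ring.
have -> : conjc c = (complex.Re c)%:C - 'i * (complex.Im c)%:C.
  by case: c => x y; apply: complex_ext => /=; ring.
rewrite rmorphN /=.
move: (D v) (D ('i *: v)) (D w) (D ('i *: w)) => X Y X' Y'.
move: (complex.Re c)%:C (complex.Im c)%:C (2^-1) => x y h.
apply/eqP; rewrite -subr_eq0; apply/eqP.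
(* [ring] does not know that i^2 = -1, so the difference of the two sides is exhibited as a multiple
   of 1 + i^2. *)
transitivity (h * y * Y * (1 + 'i * 'i)); first by ring.
by rewrite i_sq subrr mulr0.
Qed.

Lemma cdbar_cexp a v z : csmooth a ->
  cdbar (fun w => cexp (a w)) v z = cexp (a z) * cdbar a v z.
Proof. by move=> sa; rewrite /cdbar !cder_cexp//; ring. Qed.

End ScalarDolbeault.

Section Dolbeault.
Variables (n m : nat).
Implicit Types (s t : 'cV[C]_n -> 'cV[C]_m) (a : 'cV[C]_n -> C).

Lemma col_ext (x y : 'cV[C]_m) : (forall i, x i 0 = y i 0) -> x = y.
Proof. by move=> xy; apply/matrixP => i j; rewrite ord1. Qed.

Lemma smooth_delbar s v : smooth s -> smooth (delbar s v).
Proof.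
move=> /smoothP ss; apply/smoothP => i j; rewrite ord1.
by under eq_fun do rewrite delbarE; exact: (csmooth_cdbar v (ss i 0)).
Qed.

Lemma delbarD s t v z : smooth s -> smooth t ->
  delbar (fun w => s w + t w) v z = delbar s v z + delbar t v z.
Proof.
move=> /smoothP ss /smoothP st; apply: col_ext => i; rewrite addmxE !delbarE -cdbarD//.
by under eq_fun do rewrite mxE.
Qed.

Lemma delbarZ a s v z : csmooth a -> smooth s ->
  delbar (fun w => a w *: s w) v z = cdbar a v z *: s z + a z *: delbar s v z.
Proof.
move=> sa /smoothP ss; apply: col_ext => i.
rewrite [RHS]addmxE [X in _ = X + _]scalemxE [X in _ = _ + X]scalemxE !delbarE -cdbarM//.
by under eq_fun do rewrite mxE.
Qed.

Lemma delbar_cst (c : 'cV[C]_m) v (z : 'cV[C]_n) : delbar (fun _ => c) v z = 0.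
Proof. by apply: col_ext => i; rewrite delbarE cdbar_cst mxE. Qed.

Lemma delbar_mulmxl p (M : 'M[C]_(p, m)) s v z : smooth s ->
  delbar (fun w => M *m s w) v z = M *m delbar s v z.
Proof.
move=> /smoothP ss; apply/matrixP => i j; rewrite ord1 delbarE.
under eq_fun do rewrite mxE.
rewrite cdbar_sum; last by move=> k _; exact: (csmoothM (csmooth_cst _ _) (ss k 0)).
rewrite mxE; apply: eq_bigr => k _.
by rewrite cdbarM ?cdbar_cst ?mul0r ?add0r ?delbarE//; exact: csmooth_cst.
Qed.

Lemma delbar_antilinear s (c : C) v w z : smooth s ->
  delbar s (c *: v + w) z = conjc c *: delbar s v z + delbar s w z.
Proof.
move=> /smoothP ss; apply: col_ext => i; rewrite [RHS]addmxE [X in _ = X + _]scalemxE.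
apply: (etrans (delbarE _ _ _ _)).
apply: (etrans (cdbar_antilinear c v w z (ss i 0))).
exact: (f_equal2 (fun x y => conjc c * x + y)
  (esym (delbarE _ _ _ _)) (esym (delbarE _ _ _ _))).
Qed.

End Dolbeault.

Lemma smooth_scalar_mx n m (a : 'cV[C]_n -> C) :
  csmooth a -> smooth (fun z => (a z)%:M : 'M[C]_m).
Proof.
move=> sa; apply/smoothP => i j; case: (boolP (i == j)) => ij.
  by under eq_fun do rewrite mxE ij mulr1n.
by under eq_fun do rewrite mxE (negPf ij) mulr0n; exact: csmooth_cst.
Qed.

Lemma csmoothN n (a : 'cV[C]_n -> C) : csmooth a -> csmooth (fun z => - a z).
Proof.
move=> sa; under eq_fun do rewrite -mulN1r.
exact: (csmoothM (csmooth_cst _ _) sa).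
Qed.

(** * Transport of a holomorphic structure along multiplication by a nowhere vanishing scalar exp
    g *)

Section Gauge.
Variables (n m : nat) (L : 'cV[C]_n -> Prop) (E F : dbar_bundle R n m) (g : 'cV[C]_n -> C).
Hypothesis sg : csmooth g.
Hypothesis secE : forall s, sec E s <-> sec F (fun z => cexp (g z) *: s z).
Hypothesis dbarE : forall s v z, smooth s ->
  dbar F (fun z => cexp (g z) *: s z) v z = cexp (g z) *: dbar E s v z.

Let gK p (M : 'M[C]_(m, p)) z : cexp (- g z) *: (cexp (g z) *: M) = M.
Proof. by rewrite scalerA mulrC cexpK scale1r. Qed.

Let gK' p (M : 'M[C]_(m, p)) z : cexp (g z) *: (cexp (- g z) *: M) = M.
Proof. by rewrite scalerA cexpK scale1r. Qed.

Let smooth_gauge p (s : 'cV[C]_n -> 'M[C]_(m, p)) :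
  smooth (fun z => cexp (g z) *: s z) <-> smooth s.
Proof.
split=> [ss|]; last by apply: smoothZ; exact: csmooth_cexp.
have -> : s = fun z => cexp (- g z) *: (cexp (g z) *: s z).
  by apply/funext => z; rewrite gK.
by apply: smoothZ => //; apply/csmooth_cexp/csmoothN.
Qed.

Lemma dbar_gauge s v z : smooth s ->
  dbar E s v z = cexp (- g z) *: dbar F (fun z => cexp (g z) *: s z) v z.
Proof. by move=> ss; rewrite dbarE// gK. Qed.

(** The operator of [E] is the conjugate of that of [F] by exp g. A scalar commutes with matrices
    and with multiplication by functions, so each axiom passes through the conjugation, and exp(- g)
    times a holomorphic frame of [F] is one of [E]. *)
Lemma gauge_holomorphic_bundle : holomorphic_bundle L F -> holomorphic_bundle L E.
Proof.
move=> [[j jF secF] [dF1 dF2 dF3 dF4] frF].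
have sec_smooth s : sec E s -> smooth s.
  by move=> /secE/secF[ss _]; apply/smooth_gauge.
split.
(* The factor is changed by the coboundary of exp g, whose intermediate terms cancel in the cocycle
   identity. *)
- exists (fun l z => (cexp (- g (z + l)) * cexp (g z)) *: j l z).
    move=> l Ll; have [sj uj cj] := jF l Ll; split.
    + apply: smoothZ => //; apply: csmoothM; apply: csmooth_cexp => //.
      exact: (csmoothN (csmooth_shift _ sg)).
    + by move=> z; rewrite unitmxZ// unitfE mulf_neq0// cexp_neq0.
    + move=> l' Ll' z; rewrite cj// -scalemxAl -scalemxAr scalerA.
      rewrite -addrA [l' + l]addrC; congr (_ *: _).
      transitivity (cexp (- g (z + (l + l'))) *
        (cexp (g (z + l')) * cexp (- g (z + l'))) * cexp (g z)).
        by rewrite cexpK; ring.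
      by ring.
  move=> s; split=> [Es|[ss As]].
    split; first exact: sec_smooth.
    move=> l Ll z; have /secE/secF[_ /(_ l Ll z) As] := Es.
    rewrite -[LHS](gK _ (z + l)) As -scalemxAr scalerA -scalemxAl.
    by congr (_ *: _).
  apply/secE/secF; split; first exact/smooth_gauge.
  move=> l Ll z; rewrite As// -scalemxAl scalerA mulrA cexpK mul1r.
  by rewrite -scalemxAr.
- split.
  + move=> s v Es; apply/secE.
    have -> : (fun z => cexp (g z) *: dbar E s v z) = dbar F (fun z => cexp (g z) *: s z) v.
      by apply/funext => z; rewrite dbarE//; exact: sec_smooth.
    by apply: dF1; apply/secE.
  + move=> s t v z ss st; rewrite !dbar_gauge//; last exact: smoothD.
    rewrite -scalerDr -dF2; [|exact/smooth_gauge|exact/smooth_gauge].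
    by congr (_ *: dbar F _ _ _); apply/funext => w; rewrite scalerDr.
  + move=> f s v z sf ss; have sf00 : csmooth (fun z => f z 0 0) by move/smoothP: sf; apply.
    rewrite !dbar_gauge//; last exact: smoothZ.
    under [X in dbar F X _ _]eq_fun do rewrite scalerA mulrC -scalerA.
    rewrite dF3//; last exact/smooth_gauge.
    have comb (d e : C) x y : cexp (- g z) *: (d *: (cexp (g z) *: x) + e *: y) =
        d *: x + e *: (cexp (- g z) *: y) :> 'cV[C]_m.
      rewrite scalerDr !scalerA; congr (_ *: _ + _ *: _); last by rewrite mulrC.
      by rewrite mulrAC -cexpD addNr cexp0 mul1r.
    exact: comb.
  + move=> s c v w z ss; rewrite !dbar_gauge// dF4; last exact/smooth_gauge.
    by rewrite scalerDr scalerA mulrC -scalerA.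
- move=> z0; have [G sG fG] := frF z0.
  exists (fun z => cexp (- g z) *: G z).
    by apply: smoothZ => //; apply/csmooth_cexp/csmoothN.
  apply: filterS fG => p [uG dG]; split; first by rewrite unitmxZ// unitfE cexp_neq0.
  move=> c v; rewrite dbar_gauge.
    under [X in dbar F X _ _]eq_fun do rewrite -scalemxAl gK'.
    by rewrite dG scaler0.
  apply: smooth_mulmx; last exact: smooth_cst.
  by apply: smoothZ => //; apply/csmooth_cexp/csmoothN.
Qed.

(** The relation between the two operators is available on smooth functions only, whence the
    condition on the sections of [E]. *)
Lemma gauge_holomorphic_iso : (forall s, sec E s -> smooth s) ->
  holomorphic_iso E F (fun z => (cexp (g z))%:M).
Proof.
move=> Esmooth; split.
  split; first by apply: smooth_scalar_mx; exact: csmooth_cexp.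
  move=> s Es; have -> : (fun z => (cexp (g z))%:M *m s z) = fun z => cexp (g z) *: s z.
    by apply/funext => z; rewrite mul_scalar_mx.
  split; first exact/secE.
  by move=> v z; rewrite mul_scalar_mx dbarE//; exact: Esmooth.
exists (fun z => (cexp (- g z))%:M); last first.
  by move=> z; rewrite -!scalar_mxM cexpK mulrC cexpK.
split; first by apply: smooth_scalar_mx; apply: csmooth_cexp; exact: csmoothN.
move=> s Fs; have -> : (fun z => (cexp (- g z))%:M *m s z) = fun z => cexp (- g z) *: s z.
  by apply/funext => z; rewrite mul_scalar_mx.
have gs : (fun z => cexp (g z) *: (cexp (- g z) *: s z)) = s by apply/funext => z; rewrite gK'.
have Es : sec E (fun z => cexp (- g z) *: s z) by apply/secE; rewrite gs.
split => // v z; rewrite dbar_gauge; last exact: Esmooth.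
by rewrite gs mul_scalar_mx.
Qed.

End Gauge.
End MatrixDerivative.

(** * Integer powers of quasi-commuting unitary matrices *)

Section IntegerCombinations.

(** Closure under subtraction makes [P] a subgroup. This is how identities pass from generators to
    the whole lattice. *)
Lemma sum_mulrz_closed (M : zmodType) (P : M -> Prop) :
  P 0 -> (forall x y, P x -> P y -> P (x - y)) ->
  forall n (g : 'I_n -> M) (k : 'I_n -> int), (forall j, P (g j)) ->
  P (\sum_j g j *~ k j).
Proof.
move=> P0 PB n g k Pg.
have PN x : P x -> P (- x) by rewrite -sub0r; exact: PB.
have PD x y : P x -> P y -> P (x + y) by move=> Px /PN; rewrite -{2}[y]opprK; exact: PB.
have Pn x p : P x -> P (x *+ p).
  by move=> Px; elim: p => [|p IH]; rewrite ?mulr0n// mulrS; exact: PD.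
elim/big_ind: _ => // i _; case: (k i) => p; first exact: Pn.
by apply: PN; exact: Pn.
Qed.

End IntegerCombinations.

Section QuasiCommutation.
Variables (K : fieldType) (A : unitAlgType K).
Implicit Types (q : K) (x y z : A).

Definition qcomm q x y := x * y = q *: (y * x).

Lemma qcomm1r x : qcomm 1 x 1.
Proof. by rewrite /qcomm mulr1 mul1r scale1r. Qed.

Lemma qcommMr q q' x y z : qcomm q x y -> qcomm q' x z -> qcomm (q * q') x (y * z).
Proof.
move=> xy xz; rewrite /qcomm mulrA xy -scalerAl -[y * x * z]mulrA xz -scalerAr.
by rewrite mulrA scalerA.
Qed.

Lemma qcommVr q x y : q != 0 -> y \is a GRing.unit -> qcomm q x y -> qcomm q^-1 x y^-1.
Proof.
move=> q0 uy xy; rewrite /qcomm; apply: (mulrI uy); apply: (mulIr uy).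
rewrite -scalerAr -scalerAl !mulrA mulrV// mul1r -!mulrA mulVr// mulr1.
by rewrite xy scalerA mulVf// scale1r.
Qed.

Lemma qcomm_sym q x y : q != 0 -> qcomm q x y -> qcomm q^-1 y x.
Proof. by move=> q0 xy; rewrite /qcomm xy scalerA mulVf// scale1r. Qed.

Lemma qcommXr q x y p : qcomm q x y -> qcomm (q ^+ p) x (y ^+ p).
Proof.
move=> xy; elim: p => [|p IH]; first by rewrite !expr0; exact: qcomm1r.
by rewrite !exprS; exact: qcommMr.
Qed.

Lemma qcommXzr q x y (k : int) : q != 0 -> y \is a GRing.unit ->
  qcomm q x y -> qcomm (q ^ k) x (y ^ k).
Proof.
move=> q0 uy xy; case: k => p; first exact: qcommXr.
by apply: qcommVr; [rewrite expf_neq0|rewrite unitrX|exact: qcommXr].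
Qed.

Lemma qcommXzl q x y (k : int) : q != 0 -> x \is a GRing.unit ->
  qcomm q x y -> qcomm (q ^ k) (x ^ k) y.
Proof.
move=> q0 ux /(qcomm_sym q0) yx.
have := qcommXzr k (invr_neq0 q0) ux yx.
by move=> /(qcomm_sym (expfz_neq0 _ (invr_neq0 q0))); rewrite expfV invrK.
Qed.

Lemma qcomm_prodr (I : Type) (s : seq I) (q : I -> K) x (y : I -> A) :
  (forall i, qcomm (q i) x (y i)) -> qcomm (\prod_(i <- s) q i) x (\prod_(i <- s) y i).
Proof.
move=> xy; elim: s => [|i s IH]; first by rewrite !big_nil; exact: qcomm1r.
by rewrite !big_cons; exact: qcommMr.
Qed.

Lemma qcomm_prodl (I : Type) (s : seq I) (q : I -> K) (x : I -> A) y :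
  (forall i, q i != 0) ->
  (forall i, qcomm (q i) (x i) y) -> qcomm (\prod_(i <- s) q i) (\prod_(i <- s) x i) y.
Proof.
move=> q0 xy; have := qcomm_prodr s (fun i => qcomm_sym (q0 i) (xy i)).
move/qcomm_sym; rewrite prodfV invrK; apply.
rewrite invr_eq0; elim/big_ind: _ => [|a b|i _]; [exact: oner_neq0|exact: mulf_neq0|exact: q0].
Qed.

Lemma prod_expzD n (x : 'I_n -> A) (a b : 'I_n -> int) :
  (forall i, x i \is a GRing.unit) -> (forall i j, x i * x j = x j * x i) ->
  \prod_i x i ^ (a i + b i) = (\prod_i x i ^ a i) * (\prod_i x i ^ b i).
Proof.
move=> ux xx; elim: n x a b ux xx => [|n IH] x a b ux xx.
  by rewrite !big_ord0 mulr1.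
rewrite !big_ord_recl IH//.
rewrite exprzDr// -!mulrA; congr (_ * _); rewrite !mulrA; congr (_ * _).
(* Ordinary commutation is [qcomm] with scalar 1; it moves the power of the first factor across the
   product of the others. *)
have : qcomm (\prod_(i < n) (1 ^ a (lift ord0 i))) (x ord0)
    (\prod_(i < n) x (lift ord0 i) ^ a (lift ord0 i)).
  apply: qcomm_prodr => i; apply: qcommXzr => //; first exact: oner_neq0.
  by rewrite /qcomm scale1r.
rewrite big1 => [/(qcommXzl (b ord0))|i _]; last exact: exp1rz.
by rewrite exp1rz /qcomm scale1r; apply => //; exact: oner_neq0.
Qed.

End QuasiCommutation.

Section UnitaryPowers.
Variables (R : realType) (m n : nat).
Local Notation C := R[i].
Implicit Types (M : 'M[C]_m.+1) (V U : 'I_n -> 'M[C]_m.+1) (c d : 'cV[int]_n).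

Lemma cexpXz (x : C) (k : int) : cexp x ^ k = cexp (k%:~R * x).
Proof.
have pos p : cexp x ^+ p = cexp (p%:R * x).
  elim: p => [|p IH]; first by rewrite mul0r cexp0.
  by rewrite exprS IH -cexpD -natr1; congr cexp; ring.
case: k => p; first exact: pos.
rewrite NegzE -exprz_inv mulrNz mulNr cexpN -[_%:~R]/(p.+1%:R) -pos.
exact: exprVn.
Qed.

(** In the nonzero size [m.+1] the square matrices form a unit algebra, so the rules for
    quasi-commuting units apply to [mxpowz]. *)
Lemma mxpowzE M k : mxpowz M k = M ^ k.
Proof.
have pos (N : 'M[C]_m.+1) p : iter p (mulmx N) 1%:M = N ^+ p.
  by elim: p => [//|p IH]; rewrite exprS -IH.
case: k => p; first exact: pos.
exact: (etrans (pos (invmx M) p.+1) (exprVn M p.+1)).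
Qed.

(** The multi-index power V^c, spelled with [mulmx] and [mxpowz] so as to match the product
    occurring in [Up]. *)
Definition mxprodz V c : 'M[C]_m.+1 := \big[mulmx/1%:M]_(l < n) mxpowz (V l) (c l 0).

Lemma mxprodzE V c : mxprodz V c = \prod_l V l ^ c l 0.
Proof. by apply: eq_bigr => l _; rewrite mxpowzE. Qed.

Lemma mxprodz0 V : mxprodz V 0 = 1%:M.
Proof. by rewrite mxprodzE big1// => l _; rewrite mxE expr0z. Qed.

Lemma mxprodz_pow V k e : mxprodz V (\col_j (e *+ (j == k))) = V k ^ e.
Proof.
rewrite mxprodzE (eq_bigr (fun l => if l == k then V k ^ e else 1)); last first.
  by move=> l _; rewrite mxE; case: eqP => [->|_]; rewrite ?mulr1n// mulr0n expr0z.
by rewrite -big_mkcond big_pred1_eq.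
Qed.

Lemma unitarymx_pow M k : M \is unitarymx -> M ^ k \is unitarymx.
Proof.
have pos (N : 'M[C]_m.+1) p : N \is unitarymx -> N ^+ p \is unitarymx.
  move=> uN; elim: p => [|p IH]; last by rewrite exprS; exact: mul_unitarymx.
  by apply/unitarymxP; rewrite trmx1 map_mx1 mul1mx.
move=> uM; case: k => p; first exact: pos.
rewrite NegzE -exprz_inv; apply: pos.
by rewrite -[M^-1]/(invmx M) invmx_unitary// trmxC_unitary.
Qed.

Lemma mxprodz_unitary V c : (forall j, V j \is unitarymx) -> mxprodz V c \is unitarymx.
Proof.
move=> uV; rewrite mxprodzE; elim/big_ind: _ => [|x y|l _].
- by apply/unitarymxP; rewrite trmx1 map_mx1 mul1mx.
- exact: mul_unitarymx.
- exact: unitarymx_pow.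
Qed.

Lemma mxprodzD V c d : (forall j, V j \is unitarymx) ->
  (forall j k, V j *m V k = V k *m V j) ->
  mxprodz V (c + d) = mxprodz V c *m mxprodz V d.
Proof.
move=> uV VV; rewrite !mxprodzE -[RHS]prod_expzD//; last first.
  by move=> i; exact: unitarymx_unit.
by apply: eq_bigr => l _; rewrite mxE.
Qed.

(** Moving U^d across V^c makes U_k cross V_j altogether d_k c_j times, counted with sign, and each
    crossing costs the power [B k j] of [cexp x]; the exponents add up to d^t B c. *)
Lemma mxprodz_qcomm V U (x : C) (B : 'M[int]_n) c d :
  (forall j, V j \is unitarymx) -> (forall j, U j \is unitarymx) ->
  (forall j k, cexp x ^ (- B k j) *: (U k *m V j) = V j *m U k) ->
  mxprodz U d *m mxprodz V c =
    cexp (((d^T *m B *m c) 0 0)%:~R * x) *: (mxprodz V c *m mxprodz U d).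
Proof.
move=> uV uU UV.
have unV j : V j \is a GRing.unit by exact: unitarymx_unit.
have unU j : U j \is a GRing.unit by exact: unitarymx_unit.
have q0 k : cexp x ^ k != 0 by rewrite expfz_neq0// cexp_neq0.
have UVq k j : qcomm (cexp x ^ B k j) (U k) (V j).
  rewrite /qcomm -[V j * U k]UV scalerA -expfzDr ?cexp_neq0//.
  by rewrite subrr expr0z scale1r.
have UVz k j : qcomm (((cexp x ^ B k j) ^ d k 0) ^ c j 0) (U k ^ d k 0) (V j ^ c j 0).
  have q1 : (cexp x ^ B k j) ^ d k 0 != 0 by rewrite !expfz_neq0// cexp_neq0.
  refine (qcommXzr (c j 0) q1 (unV j) _).
  exact: (qcommXzl (d k 0) (q0 _) (unU k) (UVq k j)).
have UVp k : qcomm (\prod_j ((cexp x ^ B k j) ^ d k 0) ^ c j 0) (U k ^ d k 0)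
    (\prod_j V j ^ c j 0).
  exact: (qcomm_prodr _ (UVz k)).
have qp0 k : \prod_j ((cexp x ^ B k j) ^ d k 0) ^ c j 0 != 0.
  by apply/prodf_neq0 => j _; rewrite !expfz_neq0// cexp_neq0.
have := qcomm_prodl (index_enum 'I_n) qp0 UVp.
rewrite /qcomm !mxprodzE => E; apply: (etrans E); congr (_ *: _).
have expz_sum (F : 'I_n -> int) : cexp x ^ (\sum_i F i) = \prod_i cexp x ^ F i.
  apply: (big_morph (fun k : int => cexp x ^ k)) => [k l|]; last exact: expr0z.
  by rewrite expfzDr// cexp_neq0.
rewrite -cexpXz mxE.
under [in RHS]eq_bigr do rewrite mxE mulr_suml.
rewrite exchange_big /= expz_sum; apply: eq_bigr => k _.
rewrite expz_sum; apply: eq_bigr => j _.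
by rewrite [d^T 0 j]mxE !exprz_exp; congr (_ ^ _); ring.
Qed.

End UnitaryPowers.

(** * Factors of automorphy given by a Hermitian form *)

Section BilinearForms.
Variables (R : realType).
Local Notation C := R[i].

(** Bilinear rather than sesquilinear: every conjugation is written out by [mxconj], so that one set
    of rules covers both S and K. *)
Definition bil n (M : 'M[C]_n) (u w : 'cV[C]_n) : C := (u^T *m M *m w) 0 0.

Section Rules.
Variable n : nat.
Implicit Types (M N : 'M[C]_n) (u v w : 'cV[C]_n).

Lemma bilDl M u v w : bil M (u + v) w = bil M u w + bil M v w.
Proof. by rewrite /bil linearD !mulmxDl mxE. Qed.

Lemma bilDr M u v w : bil M u (v + w) = bil M u v + bil M u w.
Proof. by rewrite /bil mulmxDr mxE. Qed.

Lemma bilZl M a u w : bil M (a *: u) w = a * bil M u w.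
Proof. by rewrite /bil linearZ -!scalemxAl mxE. Qed.

Lemma bilZr M a u w : bil M u (a *: w) = a * bil M u w.
Proof. by rewrite /bil -scalemxAr mxE. Qed.

Lemma bilNl M u w : bil M (- u) w = - bil M u w.
Proof. by rewrite -scaleN1r bilZl mulN1r. Qed.

Lemma bilNr M u w : bil M u (- w) = - bil M u w.
Proof. by rewrite -scaleN1r bilZr mulN1r. Qed.

Lemma bil0l M w : bil M 0 w = 0.
Proof. by rewrite /bil trmx0 !mul0mx mxE. Qed.

Lemma bil0r M w : bil M w 0 = 0.
Proof. by rewrite /bil mulmx0 mxE. Qed.

Lemma bilDm M N u w : bil (M + N) u w = bil M u w + bil N u w.
Proof. by rewrite /bil mulmxDr mulmxDl mxE. Qed.

Lemma bilZm M a u w : bil (a *: M) u w = a * bil M u w.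
Proof. by rewrite /bil -scalemxAr -scalemxAl mxE. Qed.

Lemma bilNm M u w : bil (- M) u w = - bil M u w.
Proof. by rewrite -scaleN1r bilZm mulN1r. Qed.

Lemma bil_tr M u w : bil M u w = bil M^T w u.
Proof.
(* A 1 x 1 matrix equals its transpose. *)
rewrite /bil -[LHS](mxE trmx_key (fun i j => (u^T *m M *m w) j i)) -/(trmx _).
by rewrite !trmx_mul trmxK mulmxA.
Qed.

Lemma bil_mulr M N u w : bil M u (N *m w) = bil (M *m N) u w.
Proof. by rewrite /bil !mulmxA. Qed.

Lemma bil_mull M N u w : bil M (N *m u) w = bil (N^T *m M) u w.
Proof. by rewrite /bil trmx_mul !mulmxA. Qed.

Lemma bil_conj M u w : conjc (bil M u w) = bil (mxconj M) (mxconj u) (mxconj w).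
Proof. by rewrite /bil /mxconj map_trmx -!map_mxM [RHS]mxE. Qed.

Lemma bilE M u w : bil M u w = \sum_i \sum_j u i 0 * M i j * w j 0.
Proof.
rewrite /bil mxE exchange_big; apply: eq_bigr => j _ /=.
by rewrite mxE mulr_suml; apply: eq_bigr => i _; rewrite mxE.
Qed.

Lemma bil_delta M j k : bil M (delta_mx j 0) (delta_mx k 0) = M j k.
Proof. by rewrite /bil trmx_delta -rowE -colE !mxE. Qed.

Lemma bil_deltal M j w : bil M (delta_mx j 0) w = (M *m w) j 0.
Proof. by rewrite /bil trmx_delta -rowE -row_mul mxE. Qed.

End Rules.

Lemma mxconjK m n (M : 'M[C]_(m, n)) : mxconj (mxconj M) = M.
Proof. by apply/matrixP => i j; rewrite !mxE conjcK. Qed.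

Lemma mxconjM m n p (M : 'M[C]_(m, n)) (N : 'M[C]_(n, p)) :
  mxconj (M *m N) = mxconj M *m mxconj N.
Proof. exact: map_mxM. Qed.

Lemma mxconjD m n (M N : 'M[C]_(m, n)) : mxconj (M + N) = mxconj M + mxconj N.
Proof. exact: map_mxD. Qed.

Lemma mxconjN m n (M : 'M[C]_(m, n)) : mxconj (- M) = - mxconj M.
Proof. exact: map_mxN. Qed.

Lemma mxconjZ m n (a : C) (M : 'M[C]_(m, n)) : mxconj (a *: M) = conjc a *: mxconj M.
Proof. exact: map_mxZ. Qed.

Lemma mxconj_tr m n (M : 'M[C]_(m, n)) : mxconj M^T = (mxconj M)^T.
Proof. by rewrite /mxconj map_trmx. Qed.

Lemma mxconj_inv n (M : 'M[C]_n) : mxconj (invmx M) = invmx (mxconj M).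
Proof. exact: map_invmx. Qed.

Lemma mxconj_real m n (a : R) (M : 'M[C]_(m, n)) : mxconj (a%:C *: M) = a%:C *: mxconj M.
Proof. by rewrite mxconjZ conjc_real. Qed.

Lemma mxconj_ofZ m n (M : 'M[int]_(m, n)) : mxconj (mxofZ R M) = mxofZ R M.
Proof. by apply/matrixP => i j; rewrite !mxE rmorph_int. Qed.

Lemma mxconj_ofR m n (M : 'M[R]_(m, n)) : mxconj (mxofR M) = mxofR M.
Proof. by apply/matrixP => i j; rewrite !mxE conjc_real. Qed.

Lemma mxofR_Re m n (M : 'M[C]_(m, n)) : mxconj M = M -> mxofR (mxRe M) = M.
Proof.
move=> /matrixP MM; apply/matrixP => i j; have := MM i j; rewrite !mxE.
case: (M i j) => a b [/esym bN]; apply: complex_ext => //=.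
by apply/esym/eqP; rewrite -[_ == 0](mulrn_eq0 b 2) mulr2n {1}bN addNr.
Qed.

End BilinearForms.

(** * Cocycle identity and holomorphy of the bundle attached to a Hermitian form *)

Section FactorOfAutomorphy.
Variables (R : realType) (n m r : nat) (T : 'M[R[i]]_n) (A : 'M[int]_n).
Variable W : 'cV[R[i]]_n -> 'M[R[i]]_m.
Local Notation C := R[i].
Local Notation Rf := (Rform r m T A).

Lemma RformE z w : Rf z w = bil (Rmx r m T A) z (mxconj w).
Proof.
rewrite bilE; apply: eq_bigr => i _; apply: eq_bigr => j _.
by rewrite [mxconj w j 0]mxE [Rmx _ _ _ _ i j * _]mulrC.
Qed.

Lemma RformDl z z' w : Rf (z + z') w = Rf z w + Rf z' w.
Proof. by rewrite !RformE bilDl. Qed.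

Lemma RformDr z w w' : Rf z (w + w') = Rf z w + Rf z w'.
Proof. by rewrite !RformE mxconjD bilDr. Qed.

Lemma RformZl a z w : Rf (a *: z) w = a * Rf z w.
Proof. by rewrite !RformE bilZl. Qed.

Hypothesis herm : forall z w, Rf w z = conjc (Rf z w).
Hypothesis Wunit : forall g, lattice T g -> W g \in unitmx.
Hypothesis WM : forall g l, lattice T g -> lattice T l ->
  W (g + l) = cexp ('i / m%:R * (complex.Im (Rf l g))%:C) *: (W g *m W l).

Let exponent g z : C := (m%:R)^-1 * Rf z g + (2 * m%:R)^-1 * Rf g g.

Let exponent_smooth g : csmooth (exponent g).
Proof.
apply: (@csmoothD _ _ (fun z => (m%:R)^-1 * Rf z g) (fun=> _) _ (csmooth_cst _ _)).
apply: csmooth_real_linear => h v z.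
by rewrite RformDl RformZl; ring.
Qed.

(** The form is complex linear in its first argument, so the factor of automorphy is holomorphic in
    z. This is why the Dolbeault operator preserves the automorphy condition. *)
Let exponent_holo g v z : cdbar (exponent g) v z = 0.
Proof.
have lin (h : R) v' z' : (m%:R)^-1 * Rf (h%:C *: v' + z') g =
    h%:C * ((m%:R)^-1 * Rf v' g) + (m%:R)^-1 * Rf z' g.
  by rewrite RformDl RformZl; ring.
rewrite cdbarD ?cdbar_cst ?addr0; [|exact: csmooth_real_linear|exact: csmooth_cst].
rewrite /cdbar !cder_real_linear// RformZl.
transitivity (2^-1 * m%:R^-1 * Rf v g * (1 + 'i * 'i)); first by ring.
by rewrite i_sq subrr mulr0.
Qed.

Lemma calE_factorP : factor_of_automorphy (lattice T) (calE_factor r T A W).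
Proof.
move=> g Lg; split.
- apply: smoothZ; last exact: smooth_cst.
  exact: csmooth_cexp (exponent_smooth g).
- by move=> z; rewrite unitmxZ ?unitfE ?cexp_neq0//; exact: Wunit.
- move=> l Ll z; rewrite /calE_factor WM// scalerA -scalemxAl -scalemxAr scalerA -!cexpD.
  congr (cexp _ *: _); rewrite !(RformDl, RformDr) (herm l g).
  (* By hermitian symmetry the mixed terms (R(g, l) + R(l, g))/2 on the left are the real part of
     R(l, g); the phase of W adds i times its imaginary part, and the sum is the term R(l, g) coming
     from j(g, z + l). *)
  have -> : (complex.Im (Rf l g))%:C = (Rf l g - conjc (Rf l g)) / 2%:R * - 'i.
    by move: (Rf l g) => x; rewrite ImJ_sub complexiE; move: (conjc x) => y; ring.
  have : m%:R * (m%:R)^-1 * (m%:R)^-1 = (m%:R)^-1 :> C.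
    have [->|m0] := eqVneq (m%:R : C) 0; first by rewrite mul0r invr0 mul0r.
    by rewrite divff// mul1r.
  move: (Rf z g) (Rf z l) (Rf g g) (Rf l l) (Rf l g) (conjc _) => a b c d e f _.
  rewrite invfM; move: (m%:R)^-1 => k.
  have -> : 'i * k * ((e - f) / 2 * - 'i) = - ('i * 'i) * (k * (e - f) / 2) by ring.
  by rewrite i_sq; field.
Qed.

Lemma calE_holomorphic : holomorphic_bundle (lattice T) (calE r T A W).
Proof.
split.
- by exists (calE_factor r T A W) => //; exact: calE_factorP.
- split.
  + move=> s v [ss As]; split; first exact: smooth_delbar.
    move=> g Lg z; have uf : smooth (fun w => W g *m s w).
      by apply: smooth_mulmx => //; exact: smooth_cst.
    have E : delbar (fun w => s (w + g)) v z = calE_factor r T A W g z *m delbar s v z.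
      rewrite (_ : (fun w => s (w + g)) = fun w => cexp (exponent g w) *: (W g *m s w)).
        rewrite delbarZ//; last exact: csmooth_cexp (exponent_smooth g).
        rewrite cdbar_cexp// exponent_holo mulr0 scale0r add0r delbar_mulmxl//.
        exact: scalemxAl.
      by apply/funext => w; rewrite As// -scalemxAl.
    rewrite -E; apply: col_ext => i.
    apply: (etrans (delbarE _ _ _ _)); apply: (etrans _ (esym (delbarE _ _ _ _))).
    by congr (_ * (_ + _ * _)); apply: eq_cder => h; rewrite addrA.
  + by move=> s t v z; exact: delbarD.
  + move=> f s v z /smoothP sf ss; rewrite delbarE.
    exact: (delbarZ _ _ (sf 0 0) ss).
  + by move=> s c v w z; exact: delbar_antilinear.
- move=> z0; exists (fun=> 1%:M); first exact: smooth_cst.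
  apply: (@filterE _ (nbhs (to_real z0))) => p; split; first exact: unitmx1.
  by move=> c v; exact: delbar_cst.
Qed.

End FactorOfAutomorphy.

(** * The exponent of Psi *)

Section GaugeExponent.
Variables (R : realType) (n r m : nat).
Variables (T : 'M[R[i]]_n) (delta A : 'M[int]_n) (mu : 'cV[R[i]]_n).
Local Notation C := R[i].
Local Notation A' := (mxofZ R A).
Local Notation D := (mxofZ R delta - T).
Local Notation N := (Nmx T).
Local Notation S := (A'^T *m D).
Local Notation K := (A' *m N).
Local Notation Rf := (Rform r m T A).

Hypothesis uT : T - mxconj T \in unitmx.
Hypothesis symS : S^T = S.
Hypothesis r0 : (r%:R : C) != 0.
Hypothesis m0 : (m%:R : C) != 0.

Lemma pi_C_neq0 : (pi%:C : C) != 0.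
Proof. by rewrite (inj_eq (@complexI R) pi 0) gt_eqF// pi_gt0. Qed.

Let pi0 := pi_C_neq0.

Lemma two_piC : (2 * pi : R)%:C = 2 * pi%:C.
Proof. by rewrite rmorphM rmorph_nat. Qed.

Lemma conj_i : conjc ('i%R : C) = - 'i%R.
Proof. by apply: complex_ext => /=; rewrite ?oppr0. Qed.

Lemma conjcM (x y : C) : conjc (x * y) = conjc x * conjc y.
Proof. exact: rmorphM. Qed.

Lemma conjcD (x y : C) : conjc (x + y) = conjc x + conjc y.
Proof. exact: rmorphD. Qed.

Lemma conj_i_div (x : C) : conjc x = x -> conjc ('i / x) = - ('i / x).
Proof.
move=> xr; have E : conjc ('i / x) = conjc ('i%R : C) * conjc x^-1 by rewrite conjcM.
by rewrite E conj_i conjc_inv xr mulNr.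
Qed.

Lemma conj_nat_pi (a b : nat) : conjc (a%:R * pi%:C * b%:R : C) = a%:R * pi%:C * b%:R.
Proof.
have -> : a%:R * pi%:C * b%:R = (a%:R * pi * b%:R)%:C :> C by rewrite !rmorphM !rmorph_nat.
exact: conjc_real.
Qed.

Lemma mulNT : N *m (T - mxconj T) = 1%:M. Proof. exact: mulVmx. Qed.
Lemma mulTN : (T - mxconj T) *m N = 1%:M. Proof. exact: mulmxV. Qed.

Lemma conj_Nmx : mxconj N = - N.
Proof.
rewrite /Nmx mxconj_inv mxconjD mxconjN mxconjK -opprB.
have uT' : - (T - mxconj T) \in unitmx by rewrite -scaleN1r unitmxZ// unitrN1.
apply: (can_inj (mulKmx uT')); rewrite mulmxV// mulNmx mulmxN opprK mulTN//.
Qed.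

Lemma conj_D : mxconj D = D + (T - mxconj T).
Proof. by rewrite mxconjD mxconjN mxconj_ofZ addrA subrK. Qed.

(** A and delta are real, so conj S is symmetric along with S, and so is their difference A^t (T -
    conj T). Multiplying by N^t on the left and N on the right gives the claim. *)
Lemma symK : N^T *m A'^T = K.
Proof.
have symS' : (A'^T *m (T - mxconj T))^T = A'^T *m (T - mxconj T).
  have -> : T - mxconj T = mxconj D - D by rewrite conj_D addrAC subrr add0r.
  have : mxconj (S^T) = mxconj S by rewrite symS.
  rewrite mxconj_tr mxconjM mxconj_tr mxconj_ofZ => cS.
  by rewrite mulmxBr linearB /= cS symS.
rewrite -[A'^T]mulmx1 -mulTN !mulmxA -[N^T *m _ *m _]mulmxA -symS'.
by rewrite trmx_mul trmxK mulmxA -trmx_mul mulTN trmx1 mul1mx.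
Qed.

Lemma trK : K^T = K.
Proof. by rewrite trmx_mul symK. Qed.

Lemma conj_K : mxconj K = - K.
Proof. by rewrite mxconjM mxconj_ofZ conj_Nmx mulmxN. Qed.

(* The real coordinate y of z = x + T y, and x + delta y. *)
Definition ycoord (z : 'cV[C]_n) := N *m (z - mxconj z).
Definition Ycoord (z : 'cV[C]_n) := z + D *m ycoord z.

Lemma conj_ycoord z : mxconj (ycoord z) = ycoord z.
Proof. by rewrite mxconjM mxconjD mxconjN mxconjK conj_Nmx mulNmx -mulmxN opprB. Qed.

Lemma ycoordD z w : ycoord (z + w) = ycoord z + ycoord w.
Proof. by rewrite /ycoord mxconjD -mulmxDr opprD addrACA. Qed.

Lemma ycoordZ (h : R) z : ycoord (h%:C *: z) = h%:C *: ycoord z.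
Proof. by rewrite /ycoord mxconj_real -scalerBr scalemxAr. Qed.

Lemma ycoord_real z : mxconj z = z -> ycoord z = 0.
Proof. by move=> zr; rewrite /ycoord zr subrr mulmx0. Qed.

Lemma ycoordT w : mxconj w = w -> ycoord (T *m w) = w.
Proof. by move=> wr; rewrite /ycoord mxconjM wr -mulmxBl mulmxA mulNT mul1mx. Qed.

Lemma YcoordD z w : Ycoord (z + w) = Ycoord z + Ycoord w.
Proof. by rewrite /Ycoord ycoordD mulmxDr addrACA. Qed.

Lemma YcoordZ (h : R) z : Ycoord (h%:C *: z) = h%:C *: Ycoord z.
Proof. by rewrite /Ycoord ycoordZ -scalemxAr scalerDr. Qed.

Lemma ycoord_D w : mxconj w = w -> ycoord (D *m w) = - w.
Proof.
move=> wr; rewrite mulmxBl ycoordD -mulNmx.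
rewrite [ycoord (mxofZ R delta *m w)]ycoord_real ?mxconjM ?mxconj_ofZ ?wr// add0r.
rewrite mulNmx -[- (_ *m _)]scaleN1r -(rmorphN1 (real_complex R)) ycoordZ.
by rewrite ycoordT// rmorphN1 scaleN1r.
Qed.

Lemma Ycoord_D w : mxconj w = w -> Ycoord (D *m w) = 0.
Proof. by move=> wr; rewrite /Ycoord ycoord_D// mulmxN subrr. Qed.

Lemma Ycoord_real w : mxconj w = w -> Ycoord w = w.
Proof. by move=> wr; rewrite /Ycoord ycoord_real// mulmx0 addr0. Qed.

Lemma mulT_ycoord z : (T - mxconj T) *m ycoord z = z - mxconj z.
Proof. by rewrite mulmxA mulTN mul1mx. Qed.

Lemma conj_Ycoord z : mxconj (Ycoord z) = Ycoord z.
Proof.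
rewrite mxconjD mxconjM conj_ycoord conj_D mulmxDl mulT_ycoord.
by rewrite addrCA [mxconj z + _]addrC subrK addrC.
Qed.

Lemma Ycoord_split z : D *m (- ycoord z) + Ycoord z = z.
Proof. by rewrite mulmxN addrCA addNr addr0. Qed.

(* In these coordinates the lattice vector (c, d) has X = 2 pi c, Y = 2 pi d. *)
Definition lvec (c d : 'cV[int]_n) : 'cV[C]_n :=
  (2 * pi)%:C *: (D *m mxofZ R c + mxofZ R d).

Lemma mxofZD p q (M M' : 'M[int]_(p, q)) : mxofZ R (M + M') = mxofZ R M + mxofZ R M'.
Proof. by apply/matrixP => i j; rewrite !mxE intrD. Qed.

Lemma mxofZM p q s (M : 'M[int]_(p, q)) (M' : 'M[int]_(q, s)) :
  mxofZ R (M *m M') = mxofZ R M *m mxofZ R M'.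
Proof. exact: (map_mxM (intmul 1 : {rmorphism int -> C})). Qed.

Lemma mxofZN p q (M : 'M[int]_(p, q)) : mxofZ R (- M) = - mxofZ R M.
Proof. by apply/matrixP => i j; rewrite !mxE mulrNz. Qed.

Lemma mxofZ_tr p q (M : 'M[int]_(p, q)) : mxofZ R M^T = (mxofZ R M)^T.
Proof. by apply/matrixP => i j; rewrite !mxE. Qed.

Lemma mxofZ_delta j : mxofZ R (delta_mx j 0 : 'cV[int]_n) = delta_mx j 0.
Proof. by apply/matrixP => i k; rewrite !mxE; case: (_ && _). Qed.

Lemma lvecD c d c' d' : lvec (c + c') (d + d') = lvec c d + lvec c' d'.
Proof. by rewrite /lvec -scalerDr !mxofZD mulmxDr addrACA. Qed.

Lemma lattice_lvec c d : lattice T (lvec c d).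
Proof.
exists (d + delta *m c), (- c); congr (_ *: _).
by rewrite mxofZD mxofZM mxofZN mulmxN mulmxBl [LHS]addrC addrA.
Qed.

(** The passage from (x, y) to X = - y, Y = x + delta y is integral with integral inverse, so c and
    d parametrise the same lattice. *)
Lemma latticeP g : lattice T g -> exists c d, g = lvec c d.
Proof.
move=> [a [b ->]]; exists (- b), (a + delta *m b); congr (_ *: _).
rewrite mxofZD mxofZM mxofZN mulmxN mulmxBl opprB.
by rewrite [RHS]addrACA addNr addr0 addrC.
Qed.

Lemma ycoord_lvec c d : ycoord (lvec c d) = - ((2 * pi)%:C *: mxofZ R c).
Proof.
by rewrite ycoordZ ycoordD ycoord_D ?mxconj_ofZ// ycoord_real ?mxconj_ofZ// addr0 scalerN.
Qed.

Lemma Ycoord_lvec c d : Ycoord (lvec c d) = (2 * pi)%:C *: mxofZ R d.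
Proof.
by rewrite YcoordZ YcoordD Ycoord_D ?mxconj_ofZ// Ycoord_real ?mxconj_ofZ// add0r.
Qed.

(** The bracket is a number plus its conjugate, hence twice a real part, so [lin_part] takes
    imaginary values. It is real linear but not complex linear. *)
Definition lin_part (z : 'cV[C]_n) : C :=
  'i / (2 * pi%:C * r%:R) *
  (bil 1%:M (mxconj z) (N^T *m D^T *m mu) + bil 1%:M z (mxconj (N^T *m D^T *m mu))).

Definition gauge (z : 'cV[C]_n) : C :=
  'i / (4 * pi%:C * r%:R) * (bil S (ycoord z) (ycoord z) + bil K z z) + lin_part z.

Lemma AmxE : Amx r m T delta A = (m%:R / r%:R) *: (N^T *m S *m N).
Proof. by rewrite /Amx !mulmxA. Qed.

Lemma mxconj_lin : mxconj (N^T *m D^T *m mu) =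
  - (N^T *m (mxofZ R delta - mxconj T)^T *m mxconj mu).
Proof.
have trN : (- N)^T = - N^T by rewrite linearN.
by rewrite !mxconjM !mxconj_tr conj_Nmx mxconjD mxconjN mxconj_ofZ trN !mulNmx.
Qed.

Lemma conj_nat k : conjc (k%:R : C) = k%:R.
Proof. exact: conjc_nat. Qed.

(** Conjugation changes the sign of both factors N, which cancels, and adds T - conj T to D. The
    added term meets N and leaves N^t A^t = K. *)
Lemma conj_Amx : mxconj (Amx r m T delta A) = Amx r m T delta A + (m%:R / r%:R) *: K.
Proof.
rewrite AmxE mxconjZ fmorph_div /= !conj_nat -scalerDr; congr (_ *: _).
have trN : (- N)^T = - N^T by rewrite linearN.
rewrite !mxconjM !mxconj_tr mxconj_ofZ conj_Nmx conj_D trN !mulNmx mulmxN opprK.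
by rewrite mulmxDr mulmxDr mulmxDl -!mulmxA mulTN mulmx1 symK.
Qed.

(** After replacing conj(Amx) by Amx + (m/r) K, the three quadratic terms complete the square of z -
    conj z with matrix Amx, which is (m/r) y^t S y, and leave (m/r) z^t K z. *)
Lemma Psi_gauge z : Psi r m T delta A mu z = (cexp (gauge z))%:M.
Proof.
congr (cexp _)%:M.
rewrite -[(z^T *m mxconj _ *m z) 0 0]/(bil _ z z) -[(_^T *m _ *m mxconj z) 0 0]/(bil _ _ _)
  -[(z^T *m _ *m mxconj z) 0 0]/(bil _ _ _).
have -> : ((mxconj z)^T *m N^T *m D^T *m mu) 0 0 = bil 1%:M (mxconj z) (N^T *m D^T *m mu).
  by rewrite /bil mulmx1 !mulmxA.
have -> : (z^T *m N^T *m (mxofZ R delta - mxconj T)^T *m mxconj mu) 0 0 =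
    - bil 1%:M z (mxconj (N^T *m D^T *m mu)).
  by rewrite mxconj_lin bilNr opprK /bil mulmx1 !mulmxA.
rewrite conj_Amx bilDm AmxE !bilZm.
rewrite /gauge /lin_part /ycoord.
have bS u w : bil (N^T *m S *m N) u w = bil S (N *m u) (N *m w).
  by rewrite bil_mull bil_mulr.
rewrite !bS (mulmxBr N) bilDl !bilDr !bilNl !bilNr opprK.
rewrite [bil S (N *m mxconj z) (N *m z)]bil_tr symS.
move: (bil 1%:M _ _) (bil 1%:M _ _) (bil K _ _)
  (bil S _ _) (bil S _ _) (bil S _ _) => a b c d e f.
by move: pi0 r0 m0; move: (pi%:C) (r%:R) (m%:R) => x y w x0 y0 w0; field; rewrite x0 y0 w0.
Qed.

Lemma RmxE : Rmx r m T A = ('i / (2 * pi)%:C * (m%:R / r%:R)) *: K.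
Proof. by rewrite /Rmx symK. Qed.

Lemma Rform_bil z w : Rf z w = 'i / (2 * pi%:C) * (m%:R / r%:R) * bil K z (mxconj w).
Proof. by rewrite RformE RmxE bilZm two_piC. Qed.

(** K is symmetric and purely imaginary, and the prefactor is imaginary, so the matrix of R is real
    symmetric. *)
Lemma Rform_herm z w : Rf w z = conjc (Rf z w).
Proof.
rewrite !Rform_bil conjcM bil_conj mxconjK conj_K bilNm bil_tr trK.
have -> : conjc ('i / (2 * pi%:C) * (m%:R / r%:R)) = - ('i / (2 * pi%:C) * (m%:R / r%:R) : C).
  rewrite conjcM conj_i_div ?mulNr; last by have := conj_nat_pi 2 1; rewrite mulr1.
  by rewrite fmorph_div /= !conj_nat.
by rewrite mulrNN.
Qed.

Lemma lin_partD z w : lin_part (z + w) = lin_part z + lin_part w.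
Proof. by rewrite /lin_part mxconjD !bilDl; ring. Qed.

Lemma lin_partZ (h : R) z : lin_part (h%:C *: z) = h%:C * lin_part z.
Proof. by rewrite /lin_part mxconj_real !bilZl; ring. Qed.

Lemma gaugeD z w : gauge (z + w) = gauge z + gauge w +
  'i / (2 * pi%:C * r%:R) * (bil S (ycoord z) (ycoord w) + bil K z w).
Proof.
rewrite /gauge ycoordD lin_partD !(bilDl, bilDr).
rewrite [bil S (ycoord w) (ycoord z)]bil_tr symS [bil K w z]bil_tr trK.
move: (lin_part z) (lin_part w) (bil S _ _) (bil S _ _) (bil S _ _)
  (bil K _ _) (bil K _ _) (bil K _ _).
by move: pi0 r0; move: (pi%:C) (r%:R) => x y x0 y0 *; field; rewrite x0 y0.
Qed.

(** The polarised quadratic part of G contributes z^t K g, where R(z, g) has z^t K conj(g). They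
    differ by z^t A y(g) = - 2 pi c^t A^t z, while y(z)^t S y(g) = - 2 pi c^t A^t D y(z). Together
    these make - 2 pi c^t A^t Y(z), which the second term on the left cancels. *)
Lemma gauge_shift z c d : gauge (z + lvec c d) + 'i / r%:R * bil A'^T (mxofZ R c) (Ycoord z) =
  gauge z + gauge (lvec c d) + (m%:R)^-1 * Rf z (lvec c d).
Proof.
rewrite gaugeD Rform_bil; set g := lvec c d.
have -> : bil K z g = bil K z (mxconj g) - 2 * pi%:C * bil A'^T (mxofZ R c) z.
  have : bil K z g - bil K z (mxconj g) = - (2 * pi%:C * bil A'^T (mxofZ R c) z).
    rewrite -bilNr -bilDr -bil_mulr -/(ycoord g) ycoord_lvec bilNr bilZr two_piC bil_tr //.
  by move=> <-; rewrite addrC subrK.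
rewrite ycoord_lvec bilNr bilZr two_piC bil_tr symS -bil_mulr /Ycoord bilDr.
move: (gauge z) (gauge g) (bil K _ _) (bil A'^T _ (D *m _)) (bil A'^T _ z).
by move: pi0 r0 m0; move: (pi%:C) (r%:R) (m%:R) => x y w x0 y0 w0 *; field; rewrite x0 y0 w0.
Qed.

Lemma gauge_diag z : gauge z - (2 * m%:R)^-1 * Rf z z =
  'i / (4 * pi%:C * r%:R) *
    (bil S (ycoord z) (ycoord z) + bil K z (z - mxconj z)) + lin_part z.
Proof.
rewrite Rform_bil /gauge bilDr bilNr.
move: (lin_part z) (bil S _ _) (bil K _ _) (bil K _ _).
by move: pi0 r0 m0; move: (pi%:C) (r%:R) (m%:R) => x y w x0 y0 w0 *; field; rewrite x0 y0 w0.
Qed.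

(** The bracket in [gauge_diag] is y^t A^t D y + y^t A^t z = y^t A^t Y(z), a product of real
    quantities; its coefficient is imaginary, and so is [lin_part]. *)
Lemma gauge_diag_imag z : conjc (gauge z - (2 * m%:R)^-1 * Rf z z) =
  - (gauge z - (2 * m%:R)^-1 * Rf z z).
Proof.
rewrite gauge_diag.
have cl : conjc (lin_part z) = - lin_part z.
  rewrite /lin_part conjcM conjcD !bil_conj !mxconjK /mxconj map_mx1.
  by rewrite conj_i_div ?conj_nat_pi// [X in _ * X]addrC mulNr.
have cq : conjc (bil S (ycoord z) (ycoord z) + bil K z (z - mxconj z)) =
    bil S (ycoord z) (ycoord z) + bil K z (z - mxconj z).
  rewrite conjcD !bil_conj conj_ycoord mxconjM mxconj_tr mxconj_ofZ conj_D conj_K.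
  rewrite mulmxDr bilDm -addrA; congr (_ + _).
  rewrite mxconjD mxconjN mxconjK bilNm -bil_mulr mulT_ycoord.
  rewrite /ycoord bil_mull symK !(bilDl, bilDr, bilNl, bilNr); ring.
rewrite conjcD cl conjcM cq opprD; congr (_ - _).
by rewrite conj_i_div ?conj_nat_pi// mulNr.
Qed.

End GaugeExponent.

(** * The semi-representation *)

(** Turns a function of the lattice coordinates into a function on all of C^n; away from the image
    of [f] the default is [h x0]. *)
Lemma factor_injective (X Y Z : Type) (f : X -> Y) (h : X -> Z) (x0 : X) :
  injective f -> exists g : Y -> Z, forall x, g (f x) = h x.
Proof.
move=> finj; exists (fun y => if pselect (exists x, f x = y) is left e
  then h (projT1 (cid e)) else h x0) => x.
case: pselect => [e|[]]; last by exists x.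
by congr h; apply: finj; case: (cid e).
Qed.

Lemma oppmxE (R : realType) m n (M : 'M[R[i]]_(m, n)) i j : (- M) i j = - M i j.
Proof. by rewrite mxE. Qed.

Section SemiRepresentation.
Variables (R : realType) (n r m : nat).
Variables (T : 'M[R[i]]_n) (delta A : 'M[int]_n) (mu : 'cV[R[i]]_n).
Variables (V U : 'I_n -> 'M[R[i]]_m.+1).
Local Notation C := R[i].
Local Notation A' := (mxofZ R A).
Local Notation D := (mxofZ R delta - T).
Local Notation N := (Nmx T).
Local Notation S := (A'^T *m D).
Local Notation K := (A' *m N).
Local Notation Rf := (Rform r m.+1 T A).
Local Notation G := (gauge r T delta A mu).
Local Notation vec := (lvec T delta).

Hypothesis uT : T - mxconj T \in unitmx.
Hypothesis symS : S^T = S.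
Hypothesis r0 : (r%:R : C) != 0.
Hypothesis VU : admissible_unitaries r A V U.

Let m0 : (m.+1%:R : C) != 0. Proof. by rewrite pnatr_eq0. Qed.
Let pi0 := pi_C_neq0 R.

Lemma lvec_inj : injective (fun cd : 'cV[int]_n * 'cV[int]_n => vec cd.1 cd.2).
Proof.
have pi2 : (2 * pi : R)%:C != 0 by rewrite two_piC mulf_neq0 ?pnatr_eq0.
have ofZ_inj (x y : 'cV[int]_n) : (2 * pi)%:C *: mxofZ R x = (2 * pi)%:C *: mxofZ R y -> x = y.
  move/(scalerI pi2)/matrixP => xy; apply/matrixP => i j.
  by have := xy i j; rewrite !mxE => /eqP; rewrite eqr_int => /eqP.
move=> [c d] [c' d'] /= E; congr pair; apply: ofZ_inj.
  by have := congr1 (ycoord T) E; rewrite !ycoord_lvec// => /oppr_inj.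
by have := congr1 (Ycoord T delta) E; rewrite !Ycoord_lvec.
Qed.

Definition Wexponent (c d : 'cV[int]_n) : C :=
  G (vec c d) - (2 * m.+1%:R)^-1 * Rf (vec c d) (vec c d) +
  2 * pi%:C * 'i / r%:R * bil A'^T (mxofZ R c) (mxofZ R d).

Definition Wlvec (c d : 'cV[int]_n) : 'M[C]_m.+1 :=
  cexp (Wexponent c d) *: (mxprodz V c *m mxprodz U d).

Lemma bil_real (M : 'M[int]_n) (c d : 'cV[int]_n) :
  bil (mxofZ R M) (mxofZ R c) (mxofZ R d) = ((c^T *m M *m d) 0 0)%:~R.
Proof. by rewrite /bil -mxofZ_tr -!mxofZM mxE. Qed.

Lemma Wexponent_imag c d : conjc (Wexponent c d) = - Wexponent c d.
Proof.
rewrite /Wexponent conjcD (gauge_diag_imag mu uT symS r0 m0) [RHS]opprD; congr (_ + _).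
rewrite -mxofZ_tr bil_real; set k : C := _%:~R.
have kr : conjc k = k by exact: rmorph_int.
have -> : 2 * pi%:C * 'i / r%:R * k = 'i / (r%:R / (2 * pi%:C)) * k.
  by rewrite invfM invrK; ring.
rewrite conjcM kr conj_i_div ?mulNr// conjcM conjc_inv conj_nat.
by have := conj_nat_pi R 2 1; rewrite mulr1 => ->.
Qed.

Lemma Wlvec_unitary c d : Wlvec c d \is unitarymx.
Proof.
have [uV _ _ _] := VU.
have uM : mxprodz V c *m mxprodz U d \is unitarymx.
  by apply: mul_unitarymx; apply: mxprodz_unitary => j; have [] := uV j.
apply/unitarymxP; rewrite linearZ /= map_mxZ -scalemxAl -scalemxAr scalerA.
rewrite (unitarymxP uM).
apply: (etrans (congr1 (fun x => (cexp (Wexponent c d) * x) *: 1%:M) (cexp_conj _))).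
by rewrite Wexponent_imag cexpK scale1r.
Qed.

(** Write g = [vec c d] and g' = [vec c' d']. Reordering V^c U^d V^c' U^d' costs zeta^(d^t A c'). In
    the exponents, [gauge_shift] at z = g' contributes R(g', g)/r' and removes the cross term c^t
    A^t d'. What remains is (R(g', g) - R(g, g'))/(2r') = (i/r') Im R(g', g) together with (2 pi
    i/r) c'^t A^t d, which is exactly the reordering phase. *)
Lemma WlvecD c d c' d' : Wlvec (c + c') (d + d') =
  cexp ('i / m.+1%:R * (complex.Im (Rf (vec c' d') (vec c d)))%:C) *:
    (Wlvec c d *m Wlvec c' d').
Proof.
have [uVU VV UU UV] := VU.
have uV j : V j \is unitarymx by have [] := uVU j.
have uU j : U j \is unitarymx by have [] := uVU j.
rewrite /Wlvec !mxprodzD// -scalemxAl -scalemxAr !scalerA.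
have -> : mxprodz V c *m mxprodz U d *m (mxprodz V c' *m mxprodz U d') =
    cexp (((d^T *m A *m c') 0 0)%:~R * ((2 * pi / r%:R)%:C * 'i)) *:
      (mxprodz V c *m mxprodz V c' *m (mxprodz U d *m mxprodz U d')).
  rewrite -mulmxA [mxprodz U d *m _]mulmxA (mxprodz_qcomm _ _ uV uU UV).
  by rewrite -scalemxAl -scalemxAr !mulmxA.
rewrite !scalerA -!cexpD; congr (cexp _ *: _).
rewrite /Wexponent lvecD.
have := gauge_shift mu uT symS r0 m0 (vec c' d') c d.
rewrite Ycoord_lvec// bilZr two_piC [vec c' d' + _]addrC => /(canRL (addrK _)) ->.
rewrite !mxofZD !(bilDl, bilDr) !(RformDl, RformDr).
have ImR (x : C) : (complex.Im x)%:C = (x - conjc x) / 2%:R * - 'i.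
  by rewrite ImJ_sub complexiE; move: (conjc x) => y; ring.
rewrite ImR -(Rform_herm r m.+1 uT symS).
have -> : ((d^T *m A *m c') 0 0)%:~R = bil A'^T (mxofZ R c') (mxofZ R d).
  by rewrite bil_tr trmxK bil_real.
have -> : (2 * pi / r%:R : R)%:C = 2 * pi%:C / r%:R.
  by rewrite !rmorphM fmorphV !rmorph_nat.
have -> : 'i / m.+1%:R * ((Rf (vec c' d') (vec c d) - Rf (vec c d) (vec c' d')) / 2 * - 'i)
  = - ('i * 'i) * ((Rf (vec c' d') (vec c d) - Rf (vec c d) (vec c' d')) / (2 * m.+1%:R)).
  by rewrite invfM; ring.
rewrite i_sq.
move: (G (vec c d)) (G (vec c' d')) (Rf (vec c d) (vec c d))
  (Rf (vec c d) (vec c' d')) (Rf (vec c' d') (vec c d)) (Rf (vec c' d') (vec c' d')).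
move: (bil A'^T (mxofZ R c) (mxofZ R d)) (bil A'^T (mxofZ R c) (mxofZ R d'))
  (bil A'^T (mxofZ R c') (mxofZ R d)) (bil A'^T (mxofZ R c') (mxofZ R d')).
move: r0 m0; move: (r%:R : C) (m.+1%:R : C) (pi%:C : C) => x y w x0 y0 *.
by field; rewrite x0 y0.
Qed.

Lemma gam_lvec j : gam R j = vec 0 (delta_mx j 0).
Proof.
rewrite /gam /lvec mxofZ_delta (_ : mxofZ R 0 = 0) ?mulmx0 ?add0r//.
by apply/matrixP => i k; rewrite !mxE.
Qed.

Lemma gam'_lvec k : gam' T k = vec (- delta_mx k 0) (delta *m delta_mx k 0).
Proof.
rewrite /gam' /lvec mxofZN mxofZM mxofZ_delta; congr (_ *: _).
by rewrite mulmxN mulmxBl opprB subrK.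
Qed.

Lemma delta_real j : mxconj (delta_mx j 0 : 'cV[C]_n) = delta_mx j 0.
Proof. by rewrite -(mxofZ_delta R j) mxconj_ofZ. Qed.

Lemma Wexponent_gam j : Wexponent 0 (delta_mx j 0) =
  'i / r%:R * (N^T *m D^T *m mu) j 0
  - 'i / r%:R * (N^T *m (mxofZ R delta - mxconj T)^T *m mxconj mu) j 0.
Proof.
rewrite /Wexponent -gam_lvec (gauge_diag mu uT symS r0 m0).
have gr : mxconj (gam R j : 'cV[C]_n) = gam R j by rewrite mxconj_real delta_real.
rewrite ycoord_real// gr subrr bil0l bil0r addr0 mulr0 add0r.
rewrite (_ : mxofZ R 0 = 0); last by apply/matrixP => i k; rewrite !mxE.
rewrite bil0l mulr0 addr0 /lin_part gr /gam two_piC !bilZl !bil_deltal !mul1mx.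
rewrite mxconj_lin// oppmxE.
move: (_ j 0) (_ j 0) => a b.
by move: pi0 r0; move: (pi%:C : C) (r%:R : C) => x y x0 y0; field; rewrite x0 y0.
Qed.

Lemma diag_tr (M : 'M[C]_n) k : M^T k k = M k k.
Proof. by rewrite mxE. Qed.

(** On diagonal entries transposes disappear. The first product then becomes S N T + T^t A and the
    second S N conj(T); their difference is S + A^t T = A^t delta, from which T has dropped out. *)
Lemma Amx_diag k :
  (T^T *m mxconj (Amx r m.+1 T delta A) *m (T - mxconj T)) k k -
  ((T - mxconj T)^T *m Amx r m.+1 T delta A *m mxconj T) k k =
  m.+1%:R / r%:R * (A'^T *m mxofZ R delta) k k.
Proof.
rewrite (conj_Amx r m.+1 uT symS) AmxE -scalerDr -!(scalemxAr, scalemxAl) !scalemxE -mulrBr.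
congr (_ * _).
have -> : T^T *m (N^T *m S *m N + K) *m (T - mxconj T) = (S *m N *m T)^T + T^T *m A'.
  rewrite mulmxDr mulmxDl; congr (_ + _); last by rewrite -!mulmxA (mulNT uT) mulmx1.
  by rewrite trmx_mul (trmx_mul S N) symS -!mulmxA (mulNT uT) mulmx1.
have -> : (T - mxconj T)^T *m (N^T *m S *m N) *m mxconj T = S *m N *m mxconj T.
  by rewrite !mulmxA -trmx_mul (mulNT uT) trmx1 mul1mx.
rewrite addmxE diag_tr.
have -> : (S *m N *m T) k k = S k k + (S *m N *m mxconj T) k k.
  rewrite -addmxE; congr (fun_of_matrix _ k k).
  by rewrite -{2}[S]mulmx1 -(mulNT uT) mulmxA -mulmxDr subrK.
rewrite addrAC addrK -[(T^T *m A') k k]diag_tr trmx_mul trmxK -addmxE.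
by rewrite -mulmxDr subrK.
Qed.

(** The last term is the exponent of the power of [zeta] that [Up] carries in front of its
    matrices. *)
Lemma Wexponent_gam' k : Wexponent (- delta_mx k 0) (delta *m delta_mx k 0) =
  (pi%:C * 'i / m.+1%:R * (T^T *m mxconj (Amx r m.+1 T delta A) *m (T - mxconj T)) k k
   - pi%:C * 'i / m.+1%:R * ((T - mxconj T)^T *m Amx r m.+1 T delta A *m mxconj T) k k
   + 'i / r%:R * ((mxconj T)^T *m N^T *m D^T *m mu) k 0
   - 'i / r%:R *
     (T^T *m N^T *m (mxofZ R delta - mxconj T)^T *m mxconj mu) k 0)
  - 2 * pi%:C * 'i / r%:R * (A'^T *m mxofZ R delta) k k.
Proof.
rewrite /Wexponent -gam'_lvec (gauge_diag mu uT symS r0 m0) -mulrBr Amx_diag.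
have -> : bil A'^T (mxofZ R (- delta_mx k 0)) (mxofZ R (delta *m delta_mx k 0)) =
    - (A'^T *m mxofZ R delta) k k.
  by rewrite mxofZN mxofZM mxofZ_delta bilNl bil_mulr bil_delta.
have -> : gam' T k - mxconj (gam' T k) = (2 * pi)%:C *: ((T - mxconj T) *m delta_mx k 0).
  by rewrite mxconj_real mxconjM delta_real -scalerBr -mulmxBl.
rewrite /gam' ycoordZ ycoordT ?delta_real// !bilZl !bilZr bil_delta.
have -> : bil K (T *m delta_mx k 0) ((T - mxconj T) *m delta_mx k 0) = (A'^T *m T) k k.
  rewrite bil_mull bil_mulr bil_delta -!mulmxA (mulNT uT) mulmx1.
  by rewrite -diag_tr trmx_mul trmxK.
have -> : (A'^T *m mxofZ R delta) k k = S k k + (A'^T *m T) k k.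
  by rewrite -addmxE -mulmxDr subrK.
have -> : lin_part r T delta mu ((2 * pi)%:C *: (T *m delta_mx k 0)) =
    'i / r%:R * ((mxconj T)^T *m N^T *m D^T *m mu) k 0
   - 'i / r%:R * (T^T *m N^T *m (mxofZ R delta - mxconj T)^T *m mxconj mu) k 0.
  rewrite /lin_part mxconj_real mxconjM delta_real !bilZl !bil_mull !mulmx1 !bil_deltal.
  rewrite mxconj_lin// mulmxN oppmxE !mulmxA two_piC.
  move: (_ k 0) (_ k 0) => a b.
  by move: pi0 r0; move: (pi%:C : C) (r%:R : C) => x y x0 y0; field; rewrite x0 y0.
move: (_ k 0) (_ k 0) (S k k) (_ k k) => a b c d; rewrite two_piC.
move: pi0 r0 m0; move: (pi%:C : C) (r%:R : C) (m.+1%:R : C) => x y w x0 y0 w0.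
by field; rewrite x0 y0 w0.
Qed.

End SemiRepresentation.

(** * The pullback bundle *)

Section BilinearDerivative.
Variables (R : realType) (n : nat).
Local Notation C := R[i].
Variables (M : 'M[C]_n) (f g : 'cV[C]_n -> 'cV[C]_n).
Hypothesis flin : forall (h : R) v z, f (h%:C *: v + z) = h%:C *: f v + f z.
Hypothesis glin : forall (h : R) v z, g (h%:C *: v + z) = h%:C *: g v + g z.

Let flin_coord i (h : R) v z : f (h%:C *: v + z) i 0 = h%:C * f v i 0 + f z i 0.
Proof. by rewrite flin addmxE scalemxE. Qed.

Let glin_coord i (h : R) v z : g (h%:C *: v + z) i 0 = h%:C * g v i 0 + g z i 0.
Proof. by rewrite glin addmxE scalemxE. Qed.

Let smooth_term i j : csmooth (fun z => f z i 0 * M i j * g z j 0).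
Proof.
exact: (csmoothM (csmoothM (csmooth_real_linear (flin_coord i)) (csmooth_cst _ _))
  (csmooth_real_linear (glin_coord j))).
Qed.

Lemma csmooth_bil : csmooth (fun z => bil M (f z) (g z)).
Proof.
under eq_fun do rewrite bilE.
exact: (csmooth_sum _ (fun i _ => csmooth_sum _ (fun j _ => smooth_term i j))).
Qed.

Lemma cder_bil v z :
  cder (fun z => bil M (f z) (g z)) v z = bil M (f v) (g z) + bil M (f z) (g v).
Proof.
under eq_fun do rewrite bilE.
rewrite cder_sum => [|i _]; last exact: (csmooth_sum _ (fun j _ => smooth_term i j)).
rewrite !bilE -big_split; apply: eq_bigr => i _ /=.
rewrite cder_sum => [|j _]; last exact: smooth_term.
rewrite -big_split; apply: eq_bigr => j _ /=.
have sfi := csmooth_real_linear (flin_coord i).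
have sM := csmooth_cst n (M i j).
rewrite (cderM _ _ (csmoothM sfi sM) (csmooth_real_linear (glin_coord j))).
rewrite (cderM _ _ sfi sM) cder_cst mulr0 addr0.
by rewrite (cder_real_linear _ _ (flin_coord i)) (cder_real_linear _ _ (glin_coord j)).
Qed.

End BilinearDerivative.

(** * The (0,1)-part of the differential of the exponent *)

Section GaugeDerivative.
Variables (R : realType) (n r : nat).
Variables (T : 'M[R[i]]_n) (delta A : 'M[int]_n) (mu : 'cV[R[i]]_n).
Local Notation C := R[i].
Local Notation A' := (mxofZ R A).
Local Notation D := (mxofZ R delta - T).
Local Notation N := (Nmx T).
Local Notation S := (A'^T *m D).
Local Notation K := (A' *m N).
Local Notation G := (gauge r T delta A mu).

Hypothesis uT : T - mxconj T \in unitmx.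
Hypothesis symS : S^T = S.
Hypothesis r0 : (r%:R : C) != 0.

Let y_lin (h : R) v z : ycoord T (h%:C *: v + z) = h%:C *: ycoord T v + ycoord T z.
Proof. by rewrite ycoordD ycoordZ. Qed.

Let lin_lin (h : R) v z : lin_part r T delta mu (h%:C *: v + z) =
  h%:C * lin_part r T delta mu v + lin_part r T delta mu z.
Proof. by rewrite lin_partD lin_partZ. Qed.

Let sy : csmooth (fun z => bil S (ycoord T z) (ycoord T z)) := csmooth_bil S y_lin y_lin.
Let sz : csmooth (fun z => bil K z z) :=
  @csmooth_bil R n K id id (fun _ _ _ => erefl) (fun _ _ _ => erefl).
Let sl : csmooth (lin_part r T delta mu) := csmooth_real_linear lin_lin.

Lemma csmooth_gauge : csmooth G.
Proof.
exact: (csmoothD (csmoothM (csmooth_cst _ ('i / (4 * pi%:C * r%:R))) (csmoothD sy sz)) sl).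
Qed.

Lemma cder_gauge v z : cder G v z = 'i / (2 * pi%:C * r%:R) *
  (bil S (ycoord T z) (ycoord T v) + bil K z v) + lin_part r T delta mu v.
Proof.
have c := csmooth_cst n ('i / (4 * pi%:C * r%:R) : C).
rewrite [LHS](cderD _ _ (csmoothM c (csmoothD sy sz)) sl).
rewrite (cderM _ _ c (csmoothD sy sz)) (cderD _ _ sy sz) cder_cst mul0r add0r.
rewrite (cder_real_linear _ _ lin_lin) (cder_bil S y_lin y_lin).
rewrite (@cder_bil R n K id id (fun _ _ _ => erefl) (fun _ _ _ => erefl)) /=.
rewrite [bil S (ycoord T v) _]bil_tr symS [bil K v z]bil_tr (trK uT symS).
move: (lin_part _ _ _ _ _) (bil K _ _) (bil S _ _).
by move: (pi_C_neq0 R) r0; move: (pi%:C : C) (r%:R : C) => x y x0 y0 *; field; rewrite x0 y0.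
Qed.

Lemma mxconj_i (v : 'cV[C]_n) : mxconj ('i *: v) = - ('i *: mxconj v).
Proof. by rewrite mxconjZ conj_i scaleNr. Qed.

(* The antilinear part in v of the real coordinates of v. *)
Lemma ycoord01 v : ycoord T v + 'i *: ycoord T ('i *: v) = - (2 *: (N *m mxconj v)).
Proof.
rewrite /ycoord mxconj_i opprK -scalerDr -scalemxAr scalerA i_sq scaleN1r -mulmxBr.
rewrite opprD addrACA subrr add0r -opprD -[mxconj v]scale1r -scalerDl mulmxN -scalemxAr.
by rewrite scale1r.
Qed.

Lemma Ycoord01 v : Ycoord T delta v + 'i *: Ycoord T delta ('i *: v) =
  - (2 *: (D *m (N *m mxconj v))).
Proof.
rewrite /Ycoord scalerDr scalerA i_sq scaleN1r addrACA subrr add0r.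
by rewrite scalemxAr -mulmxDr ycoord01 mulmxN -scalemxAr.
Qed.

(** The scalar 1-form subtracted from d in the pullback connection: X is - y(z), and dY(v) is Y(v)
    by real linearity of Y. *)
Definition conn_form (z v : 'cV[C]_n) : C := 'i / (2 * pi%:C * r%:R) *
  (bil 1%:M mu (Ycoord T delta v) - bil A'^T (ycoord T z) (Ycoord T delta v)).

(** Only antilinear parts in v survive. The term z^t K v is complex linear and drops out; the
    antilinear part of Y(v) is D times that of y(v), which turns A^t into S = A^t D; and the
    surviving half of [lin_part] is the mu term. *)
Lemma cdbar_gauge v z : cdbar G v z =
  - (2^-1 * (conn_form z v + 'i * conn_form z ('i *: v))).
Proof.
have two_inv : 2^-1 * 2 = 1 :> C by rewrite mulVf ?pnatr_eq0.
rewrite /cdbar !cder_gauge.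
(* Sorted by behaviour under v -> i v: complex linear terms collect 1 + i^2 = 0, antilinear ones 1 -
   i^2 = 2. *)
have -> : 'i / (2 * pi%:C * r%:R) * (bil S (ycoord T z) (ycoord T v) + bil K z v) +
    lin_part r T delta mu v +
    'i * ('i / (2 * pi%:C * r%:R) *
      (bil S (ycoord T z) (ycoord T ('i *: v)) + bil K z ('i *: v)) +
    lin_part r T delta mu ('i *: v)) =
    'i / (2 * pi%:C * r%:R) * (bil S (ycoord T z) (ycoord T v + 'i *: ycoord T ('i *: v)) +
      (1 + 'i * 'i) * (bil K z v + bil 1%:M v (mxconj (N^T *m D^T *m mu)))
      + (1 - 'i * 'i) * bil 1%:M (mxconj v) (N^T *m D^T *m mu)).
  rewrite /lin_part mxconj_i !(bilDr, bilZr, bilZl, bilNl).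
  move: (bil 1%:M _ _) (bil 1%:M _ _) (bil K _ _)
  (bil S _ _) (bil S _ _) => a b c d e.
  ring.
rewrite i_sq subrr mul0r addr0 opprK ycoord01 bilNr bilZr.
have -> : 2^-1 * (conn_form z v + 'i * conn_form z ('i *: v)) =
    2^-1 * ('i / (2 * pi%:C * r%:R) *
     (bil 1%:M mu (Ycoord T delta v + 'i *: Ycoord T delta ('i *: v)) -
      bil A'^T (ycoord T z) (Ycoord T delta v + 'i *: Ycoord T delta ('i *: v)))).
  rewrite /conn_form !(bilDr, bilZr).
  move: (bil 1%:M _ _) (bil 1%:M _ _) (bil A'^T _ _) (bil A'^T _ _) => a b c d.
  ring.
rewrite Ycoord01 !bilNr !bilZr.
rewrite [bil A'^T _ (D *m _)]bil_mulr.
have -> : bil 1%:M mu (D *m (N *m mxconj v)) = bil 1%:M (mxconj v) (N^T *m D^T *m mu).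
  by rewrite bil_tr bil_mulr !mulmxA !bil_mull trmx1 !trmx_mul mulmx1 /bil !mulmxA mulmx1.
move: ('i / _) (bil S _ _) (bil 1%:M _ _) => k a b; ring.
Qed.

End GaugeDerivative.

(** * Existence and uniqueness of the semi-representation, and the sections of the pullback *)

Section PullbackSections.
Variables (R : realType) (n r m : nat).
Variables (T : 'M[R[i]]_n) (delta A : 'M[int]_n) (mu : 'cV[R[i]]_n).
Variables (V U : 'I_n -> 'M[R[i]]_m.+1).
Local Notation C := R[i].
Local Notation A' := (mxofZ R A).
Local Notation D := (mxofZ R delta - T).
Local Notation N := (Nmx T).
Local Notation S := (A'^T *m D).
Local Notation K := (A' *m N).
Local Notation Rf := (Rform r m.+1 T A).
Local Notation G := (gauge r T delta A mu).
Local Notation vec := (lvec T delta).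
Local Notation Tp := (Tprime T delta).
Local Notation E := (pullbackE r T delta A mu V U).

Hypothesis uT : T - mxconj T \in unitmx.
Hypothesis uD : D \in unitmx.
Hypothesis symS : S^T = S.
Hypothesis r0 : (r%:R : C) != 0.
Hypothesis VU : admissible_unitaries r A V U.

Let m0 : (m.+1%:R : C) != 0. Proof. by rewrite pnatr_eq0. Qed.
Let uV j : V j \is unitarymx. Proof. by have [uVU _ _ _] := VU; have [] := uVU j. Qed.
Let uU j : U j \is unitarymx. Proof. by have [uVU _ _ _] := VU; have [] := uVU j. Qed.
Let VV j k : V j *m V k = V k *m V j. Proof. by have [_ ->] := VU. Qed.
Let UU j k : U j *m U k = U k *m U j. Proof. by have [_ _ ->] := VU. Qed.

Lemma mxofZ0 : mxofZ R (0 : 'cV[int]_n) = 0.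
Proof. by apply/matrixP => i j; rewrite !mxE. Qed.

Lemma mxprodz_delta (M : 'I_n -> 'M[C]_m.+1) k : mxprodz M (delta_mx k 0) = M k.
Proof.
rewrite -[RHS]expr1z -mxprodz_pow; congr mxprodz; apply/matrixP => i j.
by rewrite !mxE ord1 eqxx andbT; case: eqP.
Qed.

Lemma semi_representation_exists :
  exists2 W, semi_representation r T delta A mu V U W &
    forall c d, W (vec c d) = Wlvec r T delta A mu V U c d.
Proof.
have [W WE] := factor_injective
  (fun cd => Wlvec r T delta A mu V U cd.1 cd.2) (0, 0) (lvec_inj (delta := delta) uT).
have {}WE c d : W (vec c d) = Wlvec r T delta A mu V U c d by exact: (WE (c, d)).
exists W => //; split.
- by move=> g /(latticeP delta) [c [d ->]]; rewrite WE; exact: Wlvec_unitary.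
- move=> g l /(latticeP delta) [c [d ->]] /(latticeP delta) [c' [d' ->]].
  by rewrite -lvecD !WE; exact: WlvecD.
- move=> j; rewrite (gam_lvec T delta) WE /Wlvec Wexponent_gam// mxprodz0 mul1mx.
  by rewrite mxprodz_delta.
- move=> k; rewrite (gam'_lvec T delta) WE /Wlvec Wexponent_gam'// cexpD.
  have -> : mxprodz V (- delta_mx k 0) = invmx (V k).
    rewrite -[invmx (V k)]/((V k)^-1) -exprN1 -mxprodz_pow; congr mxprodz.
    apply/matrixP => i j; rewrite !mxE ord1 eqxx andbT; case: eqP => //.
  have -> : mxprodz U (delta *m delta_mx k 0) =
      \big[mulmx/1%:M]_(l < n) mxpowz (U l) (delta l k).
    by apply: eq_bigr => l _; rewrite -colE mxE.
  rewrite /Ugam' /Up scalerA; congr (cexp _ * _ *: _); rewrite /zeta cexpXz.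
  congr cexp; rewrite rmorphN /=.
  have -> : (A'^T *m mxofZ R delta) k k = ((A^T *m delta) k k)%:~R.
    by rewrite -mxofZ_tr -mxofZM mxE.
  have -> : (2 * pi / r%:R : R)%:C = 2 * pi%:C / r%:R.
    by rewrite !rmorphM fmorphV !rmorph_nat.
  ring.
Qed.

(** Two solutions agree at 0, since W(0) is an invertible idempotent. If they agree at x and y, the
    multiplicativity rule for x = (x - y) + y gives agreement at x - y after cancelling the phase
    and the unitary W(y). So they agree on the subgroup spanned by the generators. *)
Lemma semi_representation_unique W c d : semi_representation r T delta A mu V U W ->
  W (vec c d) = Wlvec r T delta A mu V U c d.
Proof.
have [W0 [W0u W0M W0g W0g'] <-] := semi_representation_exists.
move=> [W1u W1M W1g W1g']; have := lattice_lvec T delta c d.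
suff W0E g : lattice T g -> lattice T g /\ W g = W0 g by move=> /W0E[].
move=> [a [b ->]].
have L0 : lattice T 0.
  by exists 0, 0; rewrite mxofZ0 mulmx0 addr0 scaler0.
have W00 (W2 : 'cV[C]_n -> 'M[C]_m.+1) :
    (forall g, lattice T g -> W2 g \is unitarymx) ->
    (forall g l, lattice T g -> lattice T l ->
      W2 (g + l) = cexp ('i / m.+1%:R * (complex.Im (Rf l g))%:C) *: (W2 g *m W2 l)) ->
    W2 0 = 1%:M.
  move=> W2u W2M; have := W2M 0 0 L0 L0.
  have -> : Rf 0 0 = 0 by rewrite RformE bil0l.
  rewrite addr0 mulr0 cexp0 scale1r => /(congr1 (mulmx (invmx (W2 0)))).
  by rewrite mulKmx ?mulVmx//; apply/unitarymx_unit/W2u.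
have LB x y : lattice T x -> lattice T y -> lattice T (x - y).
  move=> /(latticeP delta) [c1 [d1 ->]] /(latticeP delta) [c2 [d2 ->]].
  have -> : vec c1 d1 - vec c2 d2 = vec (c1 - c2) (d1 - d2).
    by apply/(canLR (addrK _)); rewrite -lvecD !subrK.
  exact: lattice_lvec.
have PB x y : lattice T x /\ W x = W0 x -> lattice T y /\ W y = W0 y ->
    lattice T (x - y) /\ W (x - y) = W0 (x - y).
  move=> [Lx Wx] [Ly Wy]; have Lxy := LB x y Lx Ly; split => //.
  have := W1M _ _ Lxy Ly; have := W0M _ _ Lxy Ly; rewrite subrK Wx Wy => ->.
  move/(scalerI (cexp_neq0 _)) => /(congr1 (fun M => M *m invmx (W0 y))).
  by rewrite !mulmxK //; apply/unitarymx_unit/W0u.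
have P0 : lattice T 0 /\ W 0 = W0 0 by split => //; rewrite !W00.
have Lg j : lattice T (gam R j) by rewrite (gam_lvec T delta); exact: lattice_lvec.
have Lg' k : lattice T (gam' T k) by rewrite (gam'_lvec T delta); exact: lattice_lvec.
have Pg : forall j, lattice T (gam R j) /\ W (gam R j) = W0 (gam R j).
  by move=> j; rewrite W1g W0g.
have Pg' : forall j, lattice T (gam' T j) /\ W (gam' T j) = W0 (gam' T j).
  by move=> j; rewrite W1g' W0g'.
(* Written as a difference of two sums, the shape to which closure under subtraction applies. *)
have -> : (2 * pi)%:C *: (mxofZ R a + T *m mxofZ R b) =
    \sum_j gam R j *~ a j 0 - \sum_j gam' T j *~ (- b j 0).
  have ofZE (x : 'cV[int]_n) : mxofZ R x = \sum_j (delta_mx j 0 : 'cV[C]_n) *~ x j 0.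
    have mulrzE (M : 'cV[C]_n) k i : (M *~ k) i 0 = M i 0 *~ k.
      by rewrite -[M *~ k]scaler_int mxE mulrzl.
    apply/matrixP => i k; rewrite ord1 mxE summxE (bigD1 i)//= big1 ?addr0.
      by rewrite mulrzE mxE !eqxx.
    by move=> j ji; rewrite mulrzE mxE eq_sym (negPf ji) mul0rz.
  rewrite scalerDr !ofZE mulmx_sumr !scaler_sumr -sumrN; congr (_ + _).
    by apply: eq_bigr => j _; rewrite -scalerMzr.
  apply: eq_bigr => j _; rewrite mulrNz opprK /gam'.
  by rewrite -[delta_mx j 0 *~ _]scaler_int -scalemxAr scalerA mulrC -scalerA scaler_int.
pose P g := lattice T g /\ W g = W0 g.
by have PB' := PB; apply: PB; exact: (@sum_mulrz_closed _ P P0 PB').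
Qed.

Lemma TprimeE : Tp = invmx D.
Proof. by rewrite /Tprime addrC. Qed.

Definition transition (c d : 'cV[int]_n) (z : 'cV[C]_n) : 'M[C]_m.+1 :=
  cexp ('i / r%:R * bil A'^T (mxofZ R c) (Ycoord T delta z + (2 * pi)%:C *: mxofZ R d)) *:
    (mxprodz V c *m mxprodz U d).

Lemma transition_gauge c d z :
  cexp (G (z + vec c d)) *: transition c d z =
  cexp ((m.+1%:R)^-1 * Rf z (vec c d) + (2 * m.+1%:R)^-1 * Rf (vec c d) (vec c d)) *:
    (cexp (G z) *: Wlvec r T delta A mu V U c d).
Proof.
rewrite /transition /Wlvec !scalerA -!cexpD; congr (cexp _ *: _).
rewrite bilDr bilZr mulrDr addrA (gauge_shift mu uT symS r0 m0) /Wexponent two_piC.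
ring.
Qed.

Lemma mxIm_ofXY (Q : 'M[C]_n) X Y : mxIm (ofXY Q X Y) = mxIm Q *m Y.
Proof.
apply/matrixP => i j; rewrite !mxE Im_add /= add0r.
rewrite (big_morph (@complex.Im R) (@Im_add R) (erefl _)).
apply: eq_bigr => k _; rewrite !mxE; apply: (etrans (Im_mul _ _)).
by rewrite /= mulr0 add0r.
Qed.

Lemma mxRe_ofXY (Q : 'M[C]_n) X Y : mxRe (ofXY Q X Y) = X + mxRe Q *m Y.
Proof.
apply/matrixP => i j; rewrite !mxE Re_add /=; congr (_ + _).
rewrite (big_morph (@complex.Re R) (@Re_add R) (erefl _)).
apply: eq_bigr => k _; rewrite !mxE; apply: (etrans (Re_mul _ _)).
by rewrite /= mulr0 subr0.
Qed.

Lemma coordY_ofXY (Q : 'M[C]_n) X Y : mxIm Q \in unitmx -> coordY Q (ofXY Q X Y) = Y.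
Proof. by move=> uQ; rewrite /coordY mxIm_ofXY mulKmx. Qed.

Lemma coordX_ofXY (Q : 'M[C]_n) X Y : mxIm Q \in unitmx -> coordX Q (ofXY Q X Y) = X.
Proof. by move=> uQ; rewrite /coordX coordY_ofXY// mxRe_ofXY addrK. Qed.

Lemma sub_mxconj p q (M : 'M[C]_(p, q)) : M - mxconj M = (2 * 'i) *: mxofR (mxIm M).
Proof. by apply/matrixP => i j; rewrite !mxE subcJ complexiE; ring. Qed.

Lemma unitmx_mxIm (Q : 'M[C]_n) : (mxIm Q \in unitmx) = (Q - mxconj Q \in unitmx).
Proof.
have i2 : (2 * 'i : C) \is a GRing.unit.
  by rewrite unitfE mulf_neq0 ?pnatr_eq0// neq0Ci.
by rewrite sub_mxconj unitmxZ// map_unitmx.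
Qed.

(** With T' = D^-1 one has T' - conj T' = D^-1 (conj D - D) (conj D)^-1, and conj D - D = T - conj T
    is invertible. Hence (X, Y) really are coordinates for T'. *)
Lemma mxIm_Tprime_unit : mxIm Tp \in unitmx.
Proof.
have uDc : mxconj D \in unitmx by rewrite map_unitmx.
rewrite unitmx_mxIm TprimeE mxconj_inv.
have -> : invmx D - invmx (mxconj D) = invmx D *m (T - mxconj T) *m invmx (mxconj D).
  have -> : T - mxconj T = mxconj D - D by rewrite conj_D addrAC subrr add0r.
  by rewrite mulmxBr mulVmx// mulmxBl mul1mx -mulmxA mulmxV// mulmx1.
by rewrite !unitmx_mul !unitmx_inv uD uT uDc.
Qed.

(** Multiplying z = D X + Y by T' = D^-1 gives X + T' Y. *)
Lemma Tprime_ofXY z :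
  Tp *m z = ofXY Tp (mxRe (- ycoord T z)) (mxRe (Ycoord T delta z)).
Proof.
rewrite /ofXY !mxofR_Re ?mxconjN ?conj_ycoord ?conj_Ycoord//.
by rewrite -{1}(Ycoord_split T delta z) mulmxDr TprimeE mulKmx.
Qed.

Lemma coordX_Tprime z : mxofR (coordX Tp (Tp *m z)) = - ycoord T z.
Proof.
rewrite Tprime_ofXY coordX_ofXY ?mxIm_Tprime_unit// mxofR_Re//.
by rewrite mxconjN conj_ycoord.
Qed.

Lemma coordY_Tprime z : mxofR (coordY Tp (Tp *m z)) = Ycoord T delta z.
Proof.
by rewrite Tprime_ofXY coordY_ofXY ?mxIm_Tprime_unit// mxofR_Re// conj_Ycoord.
Qed.

Lemma mulTprimeK (z : 'cV[C]_n) : invmx Tp *m (Tp *m z) = z.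
Proof. by rewrite TprimeE invmxK mulKVmx. Qed.

Lemma D_ofXY X Y : D *m ofXY Tp X Y = D *m mxofR X + mxofR Y.
Proof. by rewrite mulmxDr TprimeE mulKVmx. Qed.

Lemma Ycoord_ofXY X Y : Ycoord T delta (D *m mxofR X + mxofR Y) = mxofR Y.
Proof.
by rewrite YcoordD Ycoord_D ?mxconj_ofR// Ycoord_real ?mxconj_ofR// add0r.
Qed.

Lemma mxofRD p q (M M' : 'M[R]_(p, q)) : mxofR (M + M') = mxofR M + mxofR M'.
Proof. exact: (map_mxD (real_complex R)). Qed.

Lemma mxofR_delta j :
  mxofR ((2 * pi) *: delta_mx j 0 : 'cV[R]_n) = (2 * pi)%:C *: delta_mx j 0.
Proof.
by apply/matrixP => i k; rewrite !mxE rmorphM; congr (_ * _); case: (_ && _).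
Qed.

Lemma lvec_c0 c : vec c 0 = (2 * pi)%:C *: (D *m mxofZ R c).
Proof. by rewrite /lvec mxofZ0 addr0. Qed.

Lemma lvec_0d d : vec 0 d = (2 * pi)%:C *: mxofZ R d.
Proof. by rewrite /lvec mxofZ0 mulmx0 add0r. Qed.

Lemma sum_delta (c : 'cV[int]_n) : c = \sum_j (delta_mx j 0 : 'cV[int]_n) *~ c j 0.
Proof.
have mulrzE (M : 'cV[int]_n) k i : (M *~ k) i 0 = M i 0 *~ k.
  by rewrite -[M *~ k]scaler_int mxE mulrzl.
apply/matrixP => i k; rewrite ord1 summxE (bigD1 i)//= big1 ?addr0.
  by rewrite mulrzE mxE !eqxx intz.
by move=> j ji; rewrite mulrzE mxE eq_sym (negPf ji) mul0rz.
Qed.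

(** Shifts of Y and shifts of X are treated separately. Each family of matrices commutes, and Y is
    unchanged by shifts of X, so the phases are additive in c and both laws pass from the generators
    to their integer combinations. *)
Lemma sec_shift (t : 'cV[C]_n -> 'cV[C]_m.+1) :
  (forall z j, t (z + vec (delta_mx j 0) 0) = transition (delta_mx j 0) 0 z *m t z) ->
  (forall z j, t (z + vec 0 (delta_mx j 0)) = transition 0 (delta_mx j 0) z *m t z) ->
  forall c d z, t (z + vec c d) = transition c d z *m t z.
Proof.
move=> tV tU.
have tUd d : forall z, t (z + vec 0 d) = mxprodz U d *m t z.
  have PB x y : (forall z, t (z + vec 0 x) = mxprodz U x *m t z) ->
      (forall z, t (z + vec 0 y) = mxprodz U y *m t z) ->
      forall z, t (z + vec 0 (x - y)) = mxprodz U (x - y) *m t z.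
    move=> tx ty z; have := tx (z - vec 0 y).
    have -> : z - vec 0 y + vec 0 x = z + vec 0 (x - y).
      have -> : vec 0 x = vec 0 (x - y) + vec 0 y by rewrite -lvecD addr0 subrK.
      by rewrite addrA addrAC subrK.
    move=> ->; have := ty (z - vec 0 y); rewrite subrK => ->.
    by rewrite mulmxA -mxprodzD// subrK.
  rewrite [d]sum_delta; apply: (@sum_mulrz_closed _
    (fun d => forall z, t (z + vec 0 d) = mxprodz U d *m t z) _ PB).
    by move=> z; rewrite lvec_0d mxofZ0 scaler0 addr0 mxprodz0 mul1mx.
  move=> j z; rewrite tU /transition mxofZ0 bil0l mulr0 cexp0 scale1r.
  by rewrite mxprodz0 mul1mx.
have YD z c : Ycoord T delta (z + vec c 0) = Ycoord T delta z.
  by rewrite YcoordD Ycoord_lvec// mxofZ0 scaler0 addr0.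
pose ph c z := cexp ('i / r%:R * bil A'^T (mxofZ R c) (Ycoord T delta z)).
have phD c c' z : ph (c + c') z = ph c z * ph c' z.
  by rewrite /ph mxofZD bilDl mulrDr cexpD.
have phY c c' z : ph c (z + vec c' 0) = ph c z by rewrite /ph YD.
have tVc c : forall z, t (z + vec c 0) = ph c z *: (mxprodz V c *m t z).
  have PB x y : (forall z, t (z + vec x 0) = ph x z *: (mxprodz V x *m t z)) ->
      (forall z, t (z + vec y 0) = ph y z *: (mxprodz V y *m t z)) ->
      forall z, t (z + vec (x - y) 0) = ph (x - y) z *: (mxprodz V (x - y) *m t z).
    move=> tx ty z; have := tx (z - vec y 0).
    have -> : z - vec y 0 + vec x 0 = z + vec (x - y) 0.
      have -> : vec x 0 = vec (x - y) 0 + vec y 0 by rewrite -lvecD addr0 subrK.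
      by rewrite addrA addrAC subrK.
    move=> ->; have := ty (z - vec y 0); rewrite subrK => ->.
    have phE w : ph w (z - vec y 0) = ph w z by rewrite -(phY w y) subrK.
    rewrite !phE -scalemxAr scalerA -phD subrK.
    by rewrite mulmxA -mxprodzD// subrK.
  rewrite [c]sum_delta; apply: (@sum_mulrz_closed _
    (fun c => forall z, t (z + vec c 0) = ph c z *: (mxprodz V c *m t z)) _ PB).
    move=> z; rewrite lvec_c0 mxofZ0 mulmx0 scaler0 addr0 mxprodz0 mul1mx.
    by rewrite /ph mxofZ0 bil0l mulr0 cexp0 scale1r.
  move=> j z; rewrite tV /transition mxofZ0 scaler0 addr0 mxprodz0 mulmx1.
  by rewrite scalemxAl.
(* Y is shifted first, so that the shift of X then sees Y + 2 pi d, as in [transition]. *)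
move=> c d z; have -> : vec c d = vec 0 d + vec c 0 by rewrite -lvecD addr0 add0r.
rewrite addrA tVc tUd /transition /ph YcoordD Ycoord_lvec//.
by rewrite -scalemxAl mulmxA.
Qed.

Lemma sec_pullbackE (t : 'cV[C]_n -> 'cV[C]_m.+1) : sec E t <->
  smooth t /\ forall c d z, t (z + vec c d) = transition c d z *m t z.
Proof.
have shiftX X Y j : D *m ofXY Tp (X + (2 * pi) *: delta_mx j 0) Y =
    D *m ofXY Tp X Y + vec (delta_mx j 0) 0.
  rewrite !D_ofXY mxofRD mxofR_delta mulmxDr lvec_c0 mxofZ_delta -scalemxAr.
  by rewrite addrAC.
have shiftY X Y j : D *m ofXY Tp X (Y + (2 * pi) *: delta_mx j 0) =
    D *m ofXY Tp X Y + vec 0 (delta_mx j 0).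
  by rewrite !D_ofXY mxofRD mxofR_delta lvec_0d mxofZ_delta addrA.
have transX j z : transition (delta_mx j 0) 0 z =
    cexp ('i / r%:R * (A'^T *m Ycoord T delta z) j 0) *: V j.
  rewrite /transition mxofZ0 scaler0 addr0 mxprodz0 mulmx1 mxprodz_delta.
  by rewrite mxofZ_delta bil_deltal.
have transY j z : transition 0 (delta_mx j 0) z = U j.
  rewrite /transition mxofZ0 bil0l mulr0 cexp0 scale1r mxprodz0 mul1mx.
  exact: mxprodz_delta.
split=> [[s [ss sVU] ->]|[ts tE]].
  have sE z : s (Tp *m z) = s (ofXY Tp (mxRe (- ycoord T z)) (mxRe (Ycoord T delta z))).
    by rewrite Tprime_ofXY.
  have DTp (z : 'cV[C]_n) : D *m (Tp *m z) = z by rewrite TprimeE mulKVmx.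
  have TpD (Z : 'cV[C]_n) : Tp *m (D *m Z) = Z by rewrite TprimeE mulKmx.
  split.
    move/smoothP: ss => ss; apply/smoothP => i j.
    by have := csmooth_affine Tp 0 (ss i j); under eq_fun do rewrite addr0.
  apply: sec_shift => z j.
    have [sV _] := sVU (mxRe (- ycoord T z)) (mxRe (Ycoord T delta z)) j.
    have -> : Tp *m (z + vec (delta_mx j 0) 0) =
        ofXY Tp (mxRe (- ycoord T z) + (2 * pi) *: delta_mx j 0) (mxRe (Ycoord T delta z)).
      by rewrite -[RHS]TpD shiftX -Tprime_ofXY DTp.
    by rewrite sV transX mxofR_Re ?conj_Ycoord// -Tprime_ofXY -scalemxAl.
  have [_ sU] := sVU (mxRe (- ycoord T z)) (mxRe (Ycoord T delta z)) j.
  have -> : Tp *m (z + vec 0 (delta_mx j 0)) =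
      ofXY Tp (mxRe (- ycoord T z)) (mxRe (Ycoord T delta z) + (2 * pi) *: delta_mx j 0).
    by rewrite -[RHS]TpD shiftY -Tprime_ofXY DTp.
  by rewrite sU transY -Tprime_ofXY.
exists (fun Z => t (D *m Z)); last first.
  by apply/funext => z; rewrite TprimeE mulKVmx.
split.
  move/smoothP: ts => ts; apply/smoothP => i j.
  by have := csmooth_affine D 0 (ts i j); under eq_fun do rewrite addr0.
move=> X Y j; split.
  by rewrite shiftX tE transX D_ofXY Ycoord_ofXY -scalemxAl.
by rewrite shiftY tE transY.
Qed.

Lemma sec_gauge W t : semi_representation r T delta A mu V U W ->
  sec E t <-> sec (calE r T A W) (fun z => cexp (G z) *: t z).
Proof.
move=> sW; have WE c d := semi_representation_unique c d sW.
have facE c d z : cexp (G (z + vec c d)) *: (transition c d z *m t z) =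
    calE_factor r T A W (vec c d) z *m (cexp (G z) *: t z).
  have comb (a b e : C) (M X : 'M[C]_m.+1) (w : 'cV[C]_m.+1) :
      a *: M = e *: (b *: X) -> a *: (M *m w) = (e *: X) *m (b *: w).
    by move=> MX; rewrite scalemxAl MX -!scalemxAl -scalemxAr.
  by apply: comb; rewrite WE; exact: transition_gauge.
have sG : csmooth G := csmooth_gauge r T delta A mu.
rewrite sec_pullbackE; split=> [[ts tE]|[ts tE]].
  split; first by apply: smoothZ => //; exact: csmooth_cexp.
  move=> g /(latticeP delta) [c [d ->]] z.
  by rewrite tE facE.
split.
  have -> : t = fun z => cexp (- G z) *: (cexp (G z) *: t z).
    by apply/funext => z; rewrite scalerA mulrC cexpK scale1r.
  by apply: smoothZ => //; apply/csmooth_cexp/csmoothN.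
move=> c d z; apply: (scalerI (cexp_neq0 (G (z + vec c d)))).
by rewrite facE; apply: tE; exact: lattice_lvec.
Qed.

End PullbackSections.

(** * The pullback connection and its Dolbeault operator *)

Section PullbackConnection.
Variables (R : realType) (n r m : nat).
Variables (T : 'M[R[i]]_n) (delta A : 'M[int]_n) (mu : 'cV[R[i]]_n).
Variables (V U : 'I_n -> 'M[R[i]]_m).
Local Notation C := R[i].
Local Notation A' := (mxofZ R A).
Local Notation D := (mxofZ R delta - T).
Local Notation G := (gauge r T delta A mu).
Local Notation Tp := (Tprime T delta).

Hypothesis uT : T - mxconj T \in unitmx.
Hypothesis uD : D \in unitmx.
Hypothesis symS : (A'^T *m D)^T = A'^T *m D.
Hypothesis r0 : (r%:R : C) != 0.

Lemma conn_pullback (s : 'cV[C]_n -> 'cV[C]_m) v z i :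
  conn (pullback Tp (E_mirror r T delta A mu V U)) s v z i 0 =
  cder (fun w => s w i 0) v z - conn_form r T delta A mu z v * s z i 0.
Proof.
have subE (x y : 'cV[C]_m) (a : C) : (x - a *: y) i 0 = x i 0 - a * y i 0.
  by rewrite addmxE oppmxE scalemxE.
apply: (etrans (subE _ _ _)); congr (_ - _ * _).
- apply: (etrans (ddirE _ _ _ _ _)); apply: eq_cder => h.
  have -> : h%:C *: (Tp *m v) + Tp *m z = Tp *m (h%:C *: v + z).
    by rewrite mulmxDr -scalemxAr.
  by rewrite (mulTprimeK uD).
- rewrite (coordX_Tprime uT uD) (coordY_Tprime uT uD) two_piC.
  rewrite -scalerDr -scalemxAl scalemxE mulmxDl addmxE linearN /= !mulNmx oppmxE.
  rewrite -[((_ *m _) *m _) 0 0]/(bil A'^T (ycoord T z) (Ycoord T delta v)).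
  have -> : (mu^T *m Ycoord T delta v) 0 0 = bil 1%:M mu (Ycoord T delta v).
    by rewrite /bil mulmx1.
  rewrite /conn_form addrC !invfM; ring.
- by rewrite (mulTprimeK uD).
Qed.

Lemma dbar_pullback (s : 'cV[C]_n -> 'cV[C]_m) v z : smooth s ->
  delbar (fun w => cexp (G w) *: s w) v z =
  cexp (G z) *: dbar (pullbackE r T delta A mu V U) s v z.
Proof.
move=> ss; have sG := csmooth_gauge r T delta A mu.
apply: (etrans (delbarZ _ _ (csmooth_cexp sG) ss)).
rewrite cdbar_cexp// -scalerA -scalerDr; congr (_ *: _).
apply: col_ext => i; rewrite addmxE scalemxE.
apply/esym/(etrans (part01E _ _ _)).
apply: (etrans (part01_ext v (fun w => conn_pullback s w z i))).
rewrite (cdbar_gauge mu uT symS r0).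
apply: (etrans _ (esym (f_equal (fun x => _ + x) (delbarE s v z i)))).
rewrite /cdbar; move: (cder _ _ _) (cder _ _ _)
  (conn_form _ _ _ _ _ _ _) (conn_form _ _ _ _ _ _ _) => a b c d.
ring.
Qed.

End PullbackConnection.

(** * Consequences of the hypotheses, and the isomorphism *)

Lemma posdef_unitmx (R : realType) n (M : 'M[R]_n) :
  (forall x : 'cV[R]_n, x != 0 -> 0 < (x^T *m M *m x) 0 0) -> M \in unitmx.
Proof.
move=> Mpos; rewrite unitmxE unitfE; apply/det0P => -[v v0 vM].
have := Mpos v^T; rewrite trmx_eq0 trmxK vM mul0mx mxE ltxx => /(_ v0).
by [].
Qed.

(** Allows r' to be written [m.+1], which the matrix powers and the divisions by r' require. *)
Lemma smith_denominator_gt0 n r (A : 'M[int]_n) rp : smith_denominator r A rp -> (0 < rp)%N.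
Proof.
move=> [P [Q [d [_ _ _ ->]]]]; elim/big_ind: _ => // [x y x0 y0|a _].
  by rewrite muln_gt0 x0.
by rewrite absz_gt0 denq_eq0.
Qed.

Theorem theorem5p6
    (R : realType) (n : nat) (T : 'M[R[i]]_n) (delta : 'M[int]_n)
    (hTsing : \det T = 0)
    (hTpos : forall x : 'cV[R]_n, x != 0 -> 0 < (x^T *m mxIm T *m x) 0 0)
    (hdelta : \det (T - mxofZ R delta) != 0)
    (r : nat) (hr : (0 < r)%N)
    (A : 'M[int]_n) (r' : nat) (hr' : smith_denominator r A r')
    (p q : 'cV[R]_n) (mu : 'cV[R[i]]_n)
    (hmu : mu = mxofR p + (Tprime T delta)^T *m mxofR q)
    (V U : 'I_n -> 'M[R[i]]_r')
    (hVU : admissible_unitaries r A V U)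
    (hsym : mxofZ R A *m Tprime T delta = (mxofZ R A *m Tprime T delta)^T)
    (hsimple : simple_bundle (bundle01 (E_mirror r T delta A mu V U))) :
  (exists W, semi_representation r T delta A mu V U W) /\
  (forall W, semi_representation r T delta A mu V U W ->
    [/\ holomorphic_bundle (lattice T) (pullbackE r T delta A mu V U),
        holomorphic_bundle (lattice T) (calE r T A W)
      & holomorphic_iso (pullbackE r T delta A mu V U) (calE r T A W)
          (Psi r r' T delta A mu)]).
Proof.
have := smith_denominator_gt0 hr'; case: r' hr' V U hVU hsimple => // m _ V' U' VU _ _.
have uT : T - mxconj T \in unitmx by rewrite -unitmx_mxIm; exact: posdef_unitmx.
have uD : mxofZ R delta - T \in unitmx.
  by rewrite unitmxE unitfE -opprB -scaleN1r detZ mulf_neq0 ?signr_eq0.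
have r0 : (r%:R : R[i]) != 0 by rewrite pnatr_eq0 -lt0n.
(* Multiplying the symmetric matrix A D^-1 by D^t on the left and D on the right gives D^t A, while
   the same operation on its transpose gives A^t D. *)
have symS : ((mxofZ R A)^T *m (mxofZ R delta - T))^T = (mxofZ R A)^T *m (mxofZ R delta - T).
  have := hsym; rewrite TprimeE trmx_mul.
  move=> /(congr1 (fun M => (mxofZ R delta - T)^T *m M *m (mxofZ R delta - T))).
  rewrite -!mulmxA mulVmx// mulmx1 !mulmxA trmx_inv mulmxV ?unitmx_tr// mul1mx => E.
  by rewrite trmx_mul trmxK.
split; first by have [W sW _] := semi_representation_exists mu uT symS r0 VU; exists W.
move=> W sW.
have m0 : (m.+1%:R : R[i]) != 0 by rewrite pnatr_eq0.
have sG := csmooth_gauge r T delta A mu.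
have secG t : sec (pullbackE r T delta A mu V' U') t <->
    sec (calE r T A W) (fun z => cexp (gauge r T delta A mu z) *: t z).
  exact: sec_gauge sW.
have dbarG := dbar_pullback mu V' U' uT uD symS r0.
have holW : holomorphic_bundle (lattice T) (calE r T A W).
  have [Wu WM _ _] := sW; apply: calE_holomorphic => //.
    exact: (Rform_herm r m.+1 uT symS).
  by move=> g Lg; exact/unitarymx_unit/Wu.
split; [exact: (gauge_holomorphic_bundle sG secG dbarG holW)|exact: holW|].
have -> : Psi r m.+1 T delta A mu = fun z => (cexp (gauge r T delta A mu z))%:M.
  by apply/funext => z; exact: Psi_gauge.
apply: (gauge_holomorphic_iso sG secG dbarG) => s.
by move/(sec_pullbackE mu uT uD VU) => [].
Qed.
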